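(* Let $\{(N_n, B_n , L_n): n \ge 1\}$ be a sequence of Hadamard triples in $\mathbb{R}$. Suppose that the measures $$\mu_n= \delta_{N_{1}^{-1} B_1} * \delta_{(N_1 N_2)^{-1} B_2} * \cdots * \delta_{(N_1 N_2 \cdots N_n)^{-1} B_n }$$ converge weakly to a Borel probability measure $\mu$ on $\mathbb{R}$. For $n\ge 1$ let $$\nu_{>n}=\delta_{N_{n+1}^{-1}B_{n+1}} * \delta_{(N_{n+1}N_{n+2})^{-1}B_{n+2}} * \cdots .$$ If there exists a strictly increasing sequence $\{n_j\}_{j\ge1}$ of positive integers such that the family $\{\nu_{>n_j}: j\ge 1\}$ is equi-positive, then $\mu$ is a spectral measure with a spectrum contained in $\mathbb{Z}$.
   Context: A Hadamard triple in $\mathbb{R}$ is a triple $(N,B,L)$ where $N\in\mathbb{Z}$ with $|N|\ge 2$, and $B,L\subseteq\mathbb{Z}$ are finite sets with $\#B=\#L\ge 2$ such that the matrix $\left[\frac{1}{\sqrt{\#B}}\, e^{-2\pi i b\ell/N}\right]_{b\in B,\ \ell\in L}$ is unitary. For a finite nonempty set $A\subseteq\mathbb{R}$, $\delta_A=\frac{1}{\#A}\sum_{a\in A}\delta_a$, where $\delta_a$ is the Dirac measure at $a$; for a real number $c$, $cA=\{ca:a\in A\}$. An infinite convolution denotes the weak limit of the finite partial convolutions. Writing $\mu=\mu_n*\mu_{>n}$ with $\mu_{>n}=\delta_{(N_1\cdots N_{n+1})^{-1}B_{n+1}}*\delta_{(N_1\cdots N_{n+2})^{-1}B_{n+2}}*\cdots$,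 the measure $\nu_{>n}$ is the rescaling $\nu_{>n}(E)=\mu_{>n}\big(\tfrac{1}{N_1N_2\cdots N_n}E\big)$ for Borel sets $E$. For a Borel probability measure $\mu$ on $\mathbb{R}$, $\widehat{\mu}(\xi)=\int e^{-2\pi i\xi x}\,d\mu(x)$. A family $\Phi$ of Borel probability measures on $\mathbb{R}$ is equi-positive if there exist $\varepsilon>0$ and $\delta>0$ such that for every $x\in[0,1)$ and every $\mu\in\Phi$ there exists an integer $k_{x,\mu}\in\mathbb{Z}$ such that $|\widehat{\mu}(x+y+k_{x,\mu})|\ge\varepsilon$ for all $|y|<\delta$, where $k_{x,\mu}=0$ for $x=0$. A Borel probability measure $\mu$ on $\mathbb{R}$ is a spectral measure with spectrum $\Lambda$ if $\Lambda\subseteq\mathbb{R}$ is countable and the family of exponentials $\{e_\lambda(x)=e^{2\pi i\lambda x}:\lambda\in\Lambda\}$ forms an orthonormal basis of $L^2(\mu)$. *)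

(* Defs.v *)
From HB Require Import structures.
From mathcomp Require Import all_boot all_order all_algebra finmap.
From mathcomp Require Import complex.
From mathcomp Require Import all_classical all_reals all_analysis.

Set Implicit Arguments.
Unset Strict Implicit.
Unset Printing Implicit Defensive.

Import Order.TTheory GRing.Theory Num.Theory.
Import numFieldNormedType.Exports.

Local Open Scope classical_set_scope.
Local Open Scope ring_scope.

(* e^{i t} *)
Definition expi {R : realType} (t : R) : R[i] := Complex (cos t) (sin t).

(* [unitarymx] only asks for M M^* = 1; this is unitarity because
   [hadamard_triple] also requires #B = #L. *)
Definition hadamard_mx (R : realType) (N : int) (B L : {fset int}) :
    'M[R[i]]_(#|` B|, #|` L|) :=
  \matrix_(i, j) (((Num.sqrt (#|` B|%:R : R))^-1)%:C%C *
    expi (- (2 * pi * (nth 0 B i)%:~R * (nth 0 L j)%:~R / N%:~R))).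

Definition hadamard_triple (R : realType) (N : int) (B L : {fset int}) : Prop :=
  [/\ 2 <= `|N|, #|` B| = #|` L|, (2 <= #|` B|)%N &
      hadamard_mx R N B L \is unitarymx].

Notation borel_prob R := (probability (measurableTypeR R) R).

Section convolutions.
Context {R : realType}.

(* delta_A = (1/#A) sum_(a in A) delta_a: the sum of Dirac measures has total
   mass #A. The default \d_0 is only used when A is empty. *)
Definition delta_fset (A : {fset R}) : borel_prob R :=
  mnormalize (msum (fun i => \d_(nth 0 A i : measurableTypeR R)) #|` A|)
             (\d_(0 : measurableTypeR R)).

Definition addRR (p : measurableTypeR R * measurableTypeR R) :
  measurableTypeR R := (p.1 : R) + p.2.

Lemma measurable_addRR : measurable_fun setT addRR.
Proof.
apply: measurable_realfun.measurable_funD; [exact: measurable_fst|exact: measurable_snd].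
Qed.

HB.instance Definition _ :=
  isMeasurableFun.Build _ _ _ _ addRR measurable_addRR.

Definition convolution (mu nu : borel_prob R) : borel_prob R :=
  distribution (mu \x nu)%E addRR.

(* The sequences N, B are indexed from 1 (their values at 0 play no role).
   [partial_convolution N B n m] is
     delta_{N_{n+1}^{-1} B_{n+1}} * ... * delta_{(N_{n+1}...N_{n+m})^{-1} B_{n+m}},
   so that mu_m is the case n = 0; the empty convolution is \d_0. *)
Definition scaled_digits (N : nat -> int) (B : nat -> {fset int})
    (n k : nat) : {fset R} :=
  [fset ((\prod_(n.+1 <= i < k.+1) N i)%:~R)^-1 * (b%:~R : R) | b in B k]%fset.

Fixpoint partial_convolution (N : nat -> int) (B : nat -> {fset int})
    (n m : nat) : borel_prob R :=
  if m is m'.+1 then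
    convolution (partial_convolution N B n m')
                (delta_fset (scaled_digits N B n (n + m'.+1)))
  else \d_(0 : measurableTypeR R).

Definition weakly_cvg (mu_ : nat -> borel_prob R) (mu : borel_prob R) : Prop :=
  forall f : R -> R, continuous f -> bounded_fun f ->
    (fun n => \int[mu_ n]_x f x) @ \oo --> \int[mu]_x f x.

End convolutions.

Section fourier.
Context {R : realType}.

Definition cintegral (mu : borel_prob R) (f : R -> R[i]) : R[i] :=
  Complex (\int[mu]_x complex.Re (f x)) (\int[mu]_x complex.Im (f x)).

Definition fourier (mu : borel_prob R) (xi : R) : R[i] :=
  cintegral mu (fun x => expi (- (2 * pi * xi * x))).

Definition equi_positive (Phi : set (borel_prob R)) : Prop :=
  exists eps delta : R, [/\ 0 < eps, 0 < delta &
    forall x : R, 0 <= x < 1 -> forall mu, Phi mu ->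
      exists k : int, (x = 0 -> k = 0) /\
        forall y : R, `|y| < delta ->
          eps <= ComplexField.Normc.normc (fourier mu (x + y + k%:~R))].

(* The family { nu_{>n_j} }, where nu_{>n} is the infinite convolution
     delta_{N_{n+1}^{-1} B_{n+1}} * delta_{(N_{n+1} N_{n+2})^{-1} B_{n+2}} * ...
   i.e. the weak limit of its finite partial convolutions. Written as the set
   of all these weak limits, so that their existence (which follows from the
   weak convergence of the mu_n) is not an additional assumption. *)
Definition tail_family (N : nat -> int) (B : nat -> {fset int})
    (n_ : nat -> nat) : set (borel_prob R) :=
  [set nu | exists j, weakly_cvg (partial_convolution N B (n_ j)) nu].

(* Complex-valued L^2(mu), through representatives. *)
Definition inL2 (mu : borel_prob R) (f : R -> R[i]) : Prop :=
  ((fun x => complex.Re (f x)) : measurableTypeR R -> R) \in Lfun mu 2%:E /\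
  ((fun x => complex.Im (f x)) : measurableTypeR R -> R) \in Lfun mu 2%:E.

Definition L2inner (mu : borel_prob R) (f g : R -> R[i]) : R[i] :=
  cintegral mu (fun x => f x * (g x)^*%C).

Definition L2norm (mu : borel_prob R) (f : R -> R[i]) : \bar R :=
  ('N[mu]_2%:E[EFin \o (fun x => ComplexField.Normc.normc (f x))])%E.

(* Basis in the Hilbert space sense: the linear span is dense. *)
Definition orthonormal_basis (mu : borel_prob R) (I : eqType) (D : set I)
    (e : I -> R -> R[i]) : Prop :=
  [/\ forall i, D i -> inL2 mu (e i),
      forall i j, D i -> D j -> L2inner mu (e i) (e j) = (i == j)%:R &
      forall f, inL2 mu f -> forall eps : R, 0 < eps ->
        exists (s : seq I) (c : I -> R[i]),
          (forall i, i \in s -> D i) /\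
          (L2norm mu (fun x => f x - \sum_(i <- s) c i * e i x)%R < eps%:E)%E].

Definition is_spectrum (mu : borel_prob R) (Lambda : set R) : Prop :=
  countable Lambda /\
  orthonormal_basis mu Lambda (fun lambda x => expi (2 * pi * lambda * x)).

End fourier.

(* Main.v *)
(* The Fourier transform of mu factors as phi_n(xi) nu_n^(xi / (N_1 ... N_n)), where phi_n is
   the transform of mu_n and nu_n is the tail, which exists as a weak limit by Levy's
   continuity theorem. A Hadamard triple gives sum_(l in L) |M_B((xi + l) / N)|^2 = 1 for the
   symbol M_B, and iterating this gives spectra of all finite blocks. Adding multiples of
   N_1 ... N_n to the frequencies does not affect phi_n; equi-positivity of the tails
   allows to choose them so that, along an increasing sequence of finite integer spectra
   Lambda_j of mu_(n_j), eps |phi_(n_j)| <= |mu^| at xi + lambda for every lambda in Lambda_j, as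
   soon as xi is small compared with N_1 ... N_(n_j). Then S_j(xi) = sum_(Lambda_j) |mu^(xi + lambda)|^2
   is at most 1, because |mu^| <= |phi_(n_j)|, and its increasing limit S satisfies
   1 <= S_i + eps^-2 (S - S_i) for all i, hence S = 1. So every exponential lies in the closed
   span of the exponentials with frequencies in the union of the Lambda_j; by trigonometric
   approximation, Dynkin's theorem and truncation this closed span is all of L2(mu). *)
Require Import Defs.
From HB Require Import structures.
From mathcomp Require Import all_boot all_order all_algebra finmap.
From mathcomp Require Import complex.
From mathcomp Require Import all_classical all_reals all_analysis.
From mathcomp Require Import measurable_realfun zify ring lra.
Import Order.TTheory GRing.Theory Num.Theory.
Import numFieldNormedType.Exports HBNNSimple.
Local Open Scope classical_set_scope.
Local Open Scope ring_scope.

Set Implicit Arguments.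
Unset Strict Implicit.
Unset Printing Implicit Defensive.

(** For each n the sum over a spectrum of [mu_n] is 1, but passing to the limit under this sum gives
    only an inequality: mass can be lost along frequencies that grow with n. Equi-positivity
    supplies the missing domination, since it compares the terms of rank n_j with those of one fixed
    series, the series of |mu^|^2 over all frequencies, whose remainders are small. The condition k
    = 0 at x = 0 is what makes the spectra nested: frequencies already chosen are small against the
    new modulus, so they fall in the window around 0 and are kept. Without nesting there would be no
    increasing sum to compare with. The digit sets have no common bound, so [mu] may have unbounded
    support. Each approximation is therefore made on a bounded window and tightness controls the
    rest; this is why the approximating trigonometric polynomials have to stay bounded on the whole
    line, and why the existence of the tails needs an argument: dividing transforms fails at the
    zeros of the symbols. *)

Local Notation normc := ComplexField.Normc.normc.

(** * Complex exponentials and finite averages *)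

Section complex_exponential.
Context {R : realType}.
Implicit Types (x y t : R) (z w : R[i]).

Lemma expiD x y : expi (x + y) = expi x * expi y.
Proof. by rewrite /expi cosD sinD; congr Complex; rewrite addrC. Qed.

Lemma expi0 : expi (0 : R) = 1.
Proof. by rewrite /expi cos0 sin0. Qed.

Lemma normc_expi x : normc (expi x) = 1.
Proof. by rewrite /expi /= cos2Dsin2 sqrtr1. Qed.

Lemma expi_conj x : (expi x)^*%C = expi (- x).
Proof. by rewrite /expi /= cosN sinN. Qed.

Lemma expiMn x n : expi (x *+ n) = expi x ^+ n.
Proof.
elim: n => [|n IHn]; first by rewrite mulr0n expi0 expr0.
by rewrite mulrS expiD IHn exprS.
Qed.

Lemma expi_2pi_int (k : int) : expi (2 * pi * k%:~R : R) = 1.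
Proof.
have H (n : nat) : expi (2 * pi * n%:R : R) = 1.
  by rewrite mulr_natr expiMn mulr_natl /expi cos2pi sin2pi expr1n.
case: k => n; first exact: H.
rewrite NegzE mulrNz mulrN -expi_conj -[n.+1%:~R]/(n.+1%:R) H.
by rewrite conjc1.
Qed.

Lemma expiD_2pi_int x (k : int) : expi (x + 2 * pi * k%:~R) = expi x.
Proof. by rewrite expiD expi_2pi_int mulr1. Qed.

Lemma normcN z : normc (- z) = normc z.
Proof. by case: z => a b /=; rewrite !sqrrN. Qed.

Lemma normc_ge0 z : 0 <= normc z.
Proof. by case: z => a b /=; exact: sqrtr_ge0. Qed.

Lemma normcR x : normc (x%:C%C) = `|x|.
Proof. by rewrite /= expr0n addr0 sqrtr_sqr. Qed.

Lemma normc_sum (I : Type) (s : seq I) (F : I -> R[i]) :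
  normc (\sum_(i <- s) F i) <= \sum_(i <- s) normc (F i).
Proof.
elim/big_rec2: _ => [|i y x _ IH]; first by rewrite ComplexField.Normc.normc0.
by apply: (le_trans (le_normcD _ _)); rewrite lerD2l.
Qed.

Lemma sqr_normcE z : normc z ^+ 2 = complex.Re z ^+ 2 + complex.Im z ^+ 2.
Proof. by case: z => a b /=; rewrite sqr_sqrtr// addr_ge0// sqr_ge0. Qed.

Lemma normc_Re z : `|complex.Re z| <= normc z.
Proof.
rewrite -(@ler_sqr _ `|_|) ?nnegrE ?normc_ge0// sqr_normcE real_normK ?num_real//.
by rewrite lerDl sqr_ge0.
Qed.

Lemma mulr_conjc z : z * z^*%C = (normc z ^+ 2)%:C%C.
Proof. by case: z => a b; rewrite sqr_normcE /=; simpc; rewrite /= !expr2; congr Complex; ring. Qed.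

Lemma ReD z w : complex.Re (z + w) = complex.Re z + complex.Re w.
Proof. by case: z; case: w. Qed.
Lemma ImD z w : complex.Im (z + w) = complex.Im z + complex.Im w.
Proof. by case: z; case: w. Qed.

Lemma Re_sum (I : Type) (s : seq I) (F : I -> R[i]) :
  complex.Re (\sum_(i <- s) F i) = \sum_(i <- s) complex.Re (F i).
Proof. by elim/big_rec2: _ => // i y x _ <-; rewrite ReD. Qed.

Lemma Im_sum (I : Type) (s : seq I) (F : I -> R[i]) :
  complex.Im (\sum_(i <- s) F i) = \sum_(i <- s) complex.Im (F i).
Proof. by elim/big_rec2: _ => // i y x _ <-; rewrite ImD. Qed.

End complex_exponential.

Section averages.
Context {F : numFieldType}.

(** The field is a parameter because averages of real integrands and of complex exponentials both
    occur. *)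
Definition avg {T : Type} (s : seq T) (f : T -> F) : F :=
  (\sum_(x <- s) f x) / (size s)%:R.

Lemma eq_avg (T : eqType) (s : seq T) (f g : T -> F) :
  {in s, f =1 g} -> avg s f = avg s g.
Proof. by move=> fg; rewrite /avg; congr (_ / _); apply: eq_big_seq. Qed.

Lemma avgD (T : Type) (s : seq T) (f g : T -> F) :
  avg s (fun x => f x + g x) = avg s f + avg s g.
Proof. by rewrite /avg big_split mulrDl. Qed.

Lemma avgZ (T : Type) (s : seq T) c (f : T -> F) :
  avg s (fun x => c * f x) = c * avg s f.
Proof. by rewrite /avg -mulr_sumr mulrA. Qed.

Lemma avgN (T : Type) (s : seq T) (f : T -> F) :
  avg s (fun x => - f x) = - avg s f.
Proof. by rewrite /avg sumrN mulNr. Qed.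

Lemma avg_cst (T : Type) (s : seq T) c : (0 < size s)%N ->
  avg s (fun=> c) = c.
Proof.
move=> s0; rewrite /avg big_const_seq count_predT iter_addr addr0 -[c *+ _]mulr_natr.
by rewrite mulfK// pnatr_eq0 -lt0n.
Qed.

Lemma ler_avg (T : eqType) (s : seq T) (f g : T -> F) :
  {in s, forall x, f x <= g x} -> avg s f <= avg s g.
Proof.
move=> fg; rewrite /avg ler_wpM2r ?invr_ge0 ?ler0n//.
by rewrite !big_seq; apply: ler_sum => x; exact: fg.
Qed.

Lemma avg_sum (T I : Type) (s : seq T) (r : seq I) (f : I -> T -> F) :
  avg s (fun x => \sum_(i <- r) f i x) = \sum_(i <- r) avg s (f i).
Proof. by rewrite /avg exchange_big/= mulr_suml. Qed.

Lemma avg_map (T U : Type) (h : U -> T) (s : seq U) (f : T -> F) :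
  avg (map h s) f = avg s (f \o h).
Proof. by rewrite /avg big_map size_map. Qed.

Lemma avg_allpairs (S T U : Type) (h : S -> T -> U) (s : seq S) (t : seq T)
    (f : U -> F) :
  avg [seq h x y | x <- s, y <- t] f = avg s (fun x => avg t (fun y => f (h x y))).
Proof.
by rewrite /avg size_allpairs big_allpairs_dep/= natrM invfM mulrA mulrAC -mulr_suml.
Qed.

Lemma avgB (T : Type) (s : seq T) (f g : T -> F) :
  avg s f - avg s g = avg s (fun x => f x - g x).
Proof. by rewrite -avgN -avgD. Qed.

Lemma ler_norm_avg (T : Type) (s : seq T) (f : T -> F) :
  `|avg s f| <= avg s (fun x => `|f x|).
Proof.
by rewrite /avg normrM normfV normr_nat ler_wpM2r ?invr_ge0// ler_norm_sum.
Qed.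

End averages.

(** * Finite convolutions as uniform averages over their atoms *)

Section finite_convolutions.
Context {R : realType}.

Local Open Scope ereal_scope.

Lemma ge0_integral_delta_fset (A : {fset R}) (f : measurableTypeR R -> \bar R) :
  (0 < #|` A|)%N -> measurable_fun setT f -> (forall x, 0 <= f x) ->
  \int[delta_fset A]_x f x = ((#|` A|%:R)^-1)%:E * \sum_(a <- (A : seq R)) f a.
Proof.
move=> A0 mf f0.
have n0 : (0 <= (#|` A|%:R : R)^-1)%R by rewrite invr_ge0 ler0n.
rewrite (eq_measure_integral (mscale (NngNum n0)
   (msum (fun i => \d_(nth 0%R A i : measurableTypeR R)) #|` A|))); last first.
  move=> U mU _; rewrite /delta_fset /= /mnormalize /=.
  set M := msum _ _.
  (* The total mass #A is finite and nonzero, so [mnormalize] rescales and its default measure does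
     not occur. *)
  have -> : M [set: measurableTypeR R] = (#|` A|%:R)%:E.
    rewrite /M /msum (eq_bigr (fun=> 1%E)) => [|i _]; last exact: diracT.
    by rewrite sumEFin big_const_ord iter_addr addr0.
  by rewrite eqe pnatr_eq0 gtn_eqF//= /mscale/= muleC.
rewrite ge0_integral_mscale// ge0_integral_measure_sum//=; congr (_ * _).
rewrite (big_nth 0%R) big_mkord; apply: eq_bigr => i _.
by rewrite integral_dirac// diracT mul1e.
Qed.

Lemma ge0_integral_convolution (mu nu : borel_prob R) (f : measurableTypeR R -> \bar R) :
  measurable_fun setT f -> (forall x, 0 <= f x) ->
  \int[convolution mu nu]_x f x = \int[mu]_x \int[nu]_y f (x + y)%R.
Proof.
move=> mf f0; rewrite ge0_integral_distribution//.
rewrite fubini_tonelli1//=.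
by apply: measurableT_comp => //; exact: measurable_addRR.
Qed.

Lemma measurable_addr (a : R) : measurable_fun [set: measurableTypeR R]
  (fun x : measurableTypeR R => ((x : R) + a)%R : measurableTypeR R).
Proof. by apply: measurable_realfun.measurable_funD. Qed.

Variables (N : nat -> int) (B : nat -> {fset int}).

(** A list rather than a set: different choices of digits may give the same point, and the
    repetitions carry its mass. *)
Fixpoint atoms (n m : nat) : seq R :=
  if m is m'.+1 then
    [seq (x + a)%R | x <- atoms n m', a <- (scaled_digits N B n (n + m'.+1) : seq R)]
  else [:: 0%R].

Hypothesis B0 : forall k, (0 < k)%N -> (0 < #|` B k|)%N.

Lemma size_scaled_digits n m : (0 < m)%N -> (0 < size (scaled_digits N B n m : seq R))%N.
Proof.
move=> m0; rewrite /scaled_digits.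
have := B0 m0; rewrite !cardfs_gt0 => /fset0Pn[b bB].
by apply/fset0Pn; eexists; apply/imfsetP; exists b.
Qed.

Lemma size_atoms n m : (0 < size (atoms n m))%N.
Proof.
elim: m => //= m IH; rewrite size_allpairs muln_gt0 IH/=.
by apply: size_scaled_digits; rewrite addnS.
Qed.

Lemma ge0_integral_partial_convolution n m (f : measurableTypeR R -> \bar R) :
  measurable_fun setT f -> (forall x, 0 <= f x) ->
  \int[partial_convolution N B n m]_x f x =
  (((size (atoms n m))%:R)^-1)%:E * \sum_(x <- atoms n m) f x.
Proof.
elim: m f => [|m IH] f mf f0 /=.
  by rewrite integral_dirac// diracT mul1e big_seq1 invr1 mul1e.
have A0 : (0 < n + m.+1)%N by rewrite addnS.
rewrite ge0_integral_convolution//.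
have mfa a : measurable_fun [set: measurableTypeR R]
    (fun x : measurableTypeR R => f (x + a)%R).
  exact: (measurableT_comp mf (measurable_addr a)).
under eq_integral => x _.
  rewrite ge0_integral_delta_fset//; last 2 first.
  - exact: size_scaled_digits.
  - by under eq_fun do rewrite addrC; exact: mfa.
  over.
set A := scaled_digits _ _ _ _.
have c0 : (0 <= (#|` A|%:R : R)^-1)%R by rewrite invr_ge0 ler0n.
rewrite ge0_integralZl_EFin//; last 2 first.
- by move=> x _; apply: sume_ge0.
- by apply: emeasurable_sum => a _; exact: mfa.
rewrite ge0_integral_sum//.
rewrite size_allpairs natrM invfM [in RHS]mulrC EFinM -muleA; congr (_ * _).
rewrite (eq_bigr _ (fun a _ => IH _ (mfa a) (fun x => f0 _))).
rewrite -ge0_sume_distrr; last by move=> i _; apply: sume_ge0.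
by rewrite exchange_big/= big_allpairs_dep.
Qed.

Local Close Scope ereal_scope.

Lemma integral_partial_convolution n m (f : measurableTypeR R -> R) :
  measurable_fun setT f ->
  \int[partial_convolution N B n m]_x f x = avg (atoms n m) f.
Proof.
move=> mf; rewrite /Rintegral integralE.
have mf' : measurable_fun setT (EFin \o f) by exact/measurable_EFinP.
rewrite !ge0_integral_partial_convolution//; last 2 first.
- exact: measurable_funeneg.
- exact: measurable_funepos.
rewrite /avg mulrC; set c := (_^-1).
have -> : (\sum_(x <- atoms n m) (EFin \o f)^\+ x = (\sum_(x <- atoms n m) (f^\+%R x))%:E)%E.
  by rewrite -sumEFin; apply: eq_bigr => x _; rewrite funeposE /funrpos /= EFin_max.
have -> : (\sum_(x <- atoms n m) (EFin \o f)^\- x = (\sum_(x <- atoms n m) (f^\-%R x))%:E)%E.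
  by rewrite -sumEFin; apply: eq_bigr => x _; rewrite funenegE /funrneg /= EFin_max EFinN.
rewrite -!EFinM -EFinB /= -mulrBr -sumrB; congr (_ * _).
by apply: eq_bigr => x _; rewrite -[RHS](congr1 (@^~ x) (funrposBneg f)).
Qed.

End finite_convolutions.

(** * Approximation by trigonometric polynomials *)

Section fejer.
Context {R : realType}.
Implicit Types (x t : R).

(** Half-angle formula: cos t = 1 - 2 sin^2 (t / 2), and t / 2 lies in ]0, pi[. *)
Lemma expi_neq1 t : 0 < t < 2 * pi -> expi t != 1.
Proof.
move=> /andP[t0 t2]; apply/eqP => -[] + _.
have -> : t = (t / 2) *+ 2 by rewrite -mulr_natr mulfVK.
rewrite cos_mulr2n cos2sin2 => h.
have s0 : 0 < sin (t / 2) by apply: sin_gt0_pi; rewrite divr_gt0//= ltr_pdivrMr// mulrC.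
have : 0 < sin (t / 2) ^+ 2 by rewrite exprn_gt0.
move: h; rewrite mulr2n; lra.
Qed.

(** The phase [a] factors out and leaves a geometric sum of ratio expi (2 pi m / J); its J-th power
    is 1, and it differs from 1 because 0 < |m| < J. *)
Lemma sum_unity_roots (J : nat) (m : int) a : m != 0 -> (`|m| < J)%N ->
  \sum_(j < J) expi (m%:~R * (2 * pi * j%:R / J%:R - a)) = 0 :> R[i].
Proof.
move=> m0 mJ.
have J0 : (0 < J)%N by apply: leq_ltn_trans mJ.
have JR : J%:R != 0 :> R by rewrite pnatr_eq0 -lt0n.
pose z := expi (2 * pi * m%:~R / J%:R : R).
transitivity (expi (- (m%:~R * a)) * \sum_(j < J) z ^+ j).
  rewrite mulr_sumr; apply: eq_bigr => j _.
  rewrite /z -expiMn -expiD; congr expi.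
  rewrite -[_ *+ j]mulr_natr; field.
  exact: JR.
suff z1 : z != 1.
  have : (z - 1) * \sum_(j < J) z ^+ j = 0.
    rewrite -subrX1 /z -expiMn -[_ *+ J]mulr_natr mulfVK// expi_2pi_int subrr//.
  by move/eqP; rewrite mulf_eq0 subr_eq0 (negbTE z1)/= => /eqP ->; rewrite mulr0.
have Jp : 0 < J%:R :> R by rewrite ltr0n.
have H (k : nat) : (0 < k)%N -> (k < J)%N -> expi (2 * pi * k%:R / J%:R : R) != 1.
  move=> k0 kJ; apply: expi_neq1; have p0 := pi_gt0 R; apply/andP; split.
    by rewrite divr_gt0// mulr_gt0 ?ltr0n// mulr_gt0.
  by rewrite ltr_pdivrMr// ltr_pM2l ?ltr_nat// mulr_gt0.
rewrite /z; case: m m0 mJ {z} => k k0 kJ.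
  by apply: H => //; rewrite lt0n.
rewrite NegzE mulrNz mulrN mulNr -expi_conj.
apply: contra (H k.+1 isT kJ) => /eqP h.
by rewrite -[expi _]conjcK h conjc1.
Qed.

(* [n] times the usual Fejer kernel. *)
Definition fejer (n : nat) x : R :=
  normc (\sum_(k < n) expi (k%:R * x)) ^+ 2.

Lemma fejer_ge0 n x : 0 <= fejer n x.
Proof. exact: sqr_ge0. Qed.

Lemma fejerE n x : (fejer n x)%:C%C =
  \sum_(k < n) \sum_(l < n) expi ((k%:Z - l%:Z)%:~R * x).
Proof.
rewrite /fejer -mulr_conjc raddf_sum mulr_suml; apply: eq_bigr => k _.
rewrite mulr_sumr; apply: eq_bigr => l _.
by rewrite [X in _ * X]expi_conj -expiD; congr expi; rewrite intrD mulrDl mulrNz mulNr.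
Qed.

Let node (J : nat) (j : nat) : R := pi - 2 * pi * j%:R / J%:R.

Let nodeE (J j : nat) x : x - node J j = 2 * pi * j%:R / J%:R - (pi - x).
Proof. by rewrite /node; lra. Qed.

(* Only frequencies of modulus < n + 1 occur, so a sum over n + 1 equispaced nodes
   picks out the constant coefficient exactly. *)
Lemma sum_fejer_nodes n x :
  \sum_(j < n.+1) fejer n (x - node n.+1 j) = n%:R * n.+1%:R.
Proof.
apply: (@complexI R); rewrite raddf_sum /=.
under eq_bigr do rewrite fejerE.
rewrite exchange_big/=.
transitivity (\sum_(k < n) (n.+1%:R : R[i])); last first.
  by rewrite sumr_const card_ord rmorphM !rmorph_nat mulr_natl.
apply: eq_bigr => k _; rewrite exchange_big/= (bigD1 k)//=.
rewrite [X in _ + X]big1 ?addr0 => [|l lk].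
  under eq_bigr do rewrite subrr mul0r expi0.
  by rewrite sumr_const card_ord.
under eq_bigr => j _.
  rewrite nodeE.
  over.
apply: sum_unity_roots.
  by rewrite subr_eq0 eqz_nat eq_sym.
by rewrite ltnS; have := ltn_ord k; have := ltn_ord l; lia.
Qed.

(** Multiplying by [expi] raises every frequency by one, so only the n - 1 pairs with l = k + 1
    survive. The largest frequency is now n, which is why n + 1 nodes are taken. *)
Lemma sum_fejer_cos_nodes n x :
  \sum_(j < n.+1) fejer n (x - node n.+1 j) * cos (x - node n.+1 j) = n.-1%:R * n.+1%:R.
Proof.
pose S := \sum_(j < n.+1) (fejer n (x - node n.+1 j))%:C%C * expi (x - node n.+1 j).
suff SE : S = (n.-1%:R * n.+1%:R : R)%:C%C.
  transitivity (complex.Re S); last by rewrite SE.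
  rewrite /S Re_sum; apply: eq_bigr => j _.
  by rewrite /expi; simpc.
rewrite /S; under eq_bigr => j _.
  rewrite fejerE mulr_suml.
  under eq_bigr => k _.
    rewrite mulr_suml.
    under eq_bigr => l _.
      rewrite -expiD -[X in _ + X]mul1r -mulrDl -[1 in X in expi (X * _)]/(1%:~R) -intrD.
      rewrite nodeE.
      over.
    over.
  over.
rewrite exchange_big/=.
transitivity (\sum_(k < n) (if (k.+1 < n)%N then (n.+1%:R : R[i]) else 0)).
  apply: eq_bigr => k _; rewrite exchange_big/=.
  have H (l : 'I_n) : (l : nat) != k.+1 -> \sum_(j < n.+1)
      expi ((k%:Z - l%:Z + 1)%:~R * (2 * pi * j%:R / n.+1%:R - (pi - x))) = 0.
    move=> lk; apply: sum_unity_roots.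
      by apply: contra lk => /eqP h; apply/eqP; lia.
    by have := ltn_ord k; have := ltn_ord l; lia.
  case: ifPn => kn; last first.
    rewrite big1// => l _; apply: H; have := ltn_ord l; lia.
  rewrite (bigD1 (Ordinal kn))//= [X in _ + X]big1 ?addr0 => [|l lk]; last first.
    by apply: H; apply: contra lk => /eqP h; apply/eqP/val_inj.
  have -> : k%:Z - (Ordinal kn : nat)%:Z + 1 = 0 by rewrite /=; lia.
  under eq_bigr do rewrite mul0r expi0.
  by rewrite sumr_const card_ord.
clear S; case: n => [|n]; first by rewrite big_ord0 mul0r.
rewrite big_ord_recr/= ltnn addr0.
under eq_bigr => k _ do rewrite ltnS ltn_ord.
by rewrite sumr_const card_ord rmorphM !rmorph_nat mulr_natl.
Qed.

End fejer.

Section trigonometric_approximation.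
Context {R : realType}.

Definition trig (g : R -> R[i]) : Prop :=
  exists s : seq (R[i] * R), forall x, g x = \sum_(p <- s) p.1 * expi (p.2 * x).

Lemma trig_expi c w : trig (fun x => c * expi (w * x)).
Proof. by exists [:: (c, w)] => x; rewrite big_seq1. Qed.

Lemma trigD f g : trig f -> trig g -> trig (fun x => f x + g x).
Proof. by move=> [s hs] [t ht]; exists (s ++ t) => x; rewrite big_cat/= hs ht. Qed.

Lemma trig_sum (I : Type) (r : seq I) (f : I -> R -> R[i]) :
  (forall i, trig (f i)) -> trig (fun x => \sum_(i <- r) f i x).
Proof.
move=> tf; elim: r => [|i r IH].
  by exists [::] => x; rewrite !big_nil.
by under [X in trig X]eq_fun do rewrite big_cons; exact: trigD.
Qed.

Lemma trigZ c f : trig f -> trig (fun x => c * f x).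
Proof.
move=> [s hs]; exists [seq (c * p.1, p.2) | p <- s] => x.
by rewrite big_map hs mulr_sumr; apply: eq_bigr => p _; rewrite mulrA.
Qed.

(** Only [x] is confined to the segment: [y] may leave it, as Fejer nodes and the end of the last
    interpolation cell do. *)
Lemma uniform_continuity_segment (f : R -> R) (M e : R) :
  continuous f -> 0 < e ->
  exists2 d, 0 < d & forall x y, `|x| <= M -> `|x - y| < d -> `|f x - f y| < e.
Proof.
move=> cf e0.
have K : compact `[- M, M]%classic := @segment_compact R _ _.
pose P (d x : R) := forall y, `|x - y| < d -> `|f x - f y| < e.
have : \forall d \near (0 : R)^'+, `[- M, M]%classic `<=` P d.
  apply: (compact_near_coveringP _).1 K _ _ _ _ _ => x _.
  have /cvgrPdist_lt /(_ (e / 2)) : f y @[y --> x] --> f x := cf x.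
  rewrite divr_gt0// => /(_ isT) /nbhs_ballP[d /= d0 hd].
  exists (ball x (d / 2), [set t | t < d / 2]) => /=.
    split; first by apply: nbhsx_ballx; rewrite divr_gt0.
    by apply: nbhs_right_lt; rewrite divr_gt0.
  move=> [x' t] /= [xx' td] y x'y.
  have h1 : `|f x - f x'| < e / 2.
    by apply: hd; apply: lt_trans xx' _; rewrite ltr_pdivrMr// ltr_pMr// ltr1n.
  have h2 : `|f x - f y| < e / 2.
    apply: hd; rewrite /ball/=.
    have := ler_distD x' x y; move: xx'; rewrite /ball/=; lra.
  have := ler_distD (f x) (f x') (f y); have := distrC (f x) (f x'); lra.
move=> H.
have [d [d0 hd]] : exists d : R, 0 < d /\ `[- M, M]%classic `<=` P d.
  near ((0 : R)^'+) => d; exists d; split => //.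
  by near: d.
exists d => // x y xM xy; apply: hd => //=.
by rewrite in_itv/= -ler_norml.
Unshelve. all: end_near. Qed.

(** A point of [-1, 1] and a node of [-pi, pi] are at distance at most pi + 1. Beyond pi, the
    reflection t -> 2 pi - t returns to [pi - 1, pi], still to the right of a <= 1. *)
Lemma cos_le_far (a s : R) : 0 < a -> a <= 1 -> a <= `|s| -> `|s| <= pi + 1 ->
  cos s <= cos a.
Proof.
move=> a0 a1 as_ s1; have p2 := pi_ge2 R.
rewrite -(cos_norm s); move: as_ s1; move: (`|s|) => t at_ t1.
have aI : a \in `[0, pi] by rewrite in_itv/=; apply/andP; split; lra.
have H u : a <= u -> u <= pi -> cos u <= cos a.
  move=> au up; rewrite leNgt; apply/negP; rewrite ltr_cos ?in_itv//= 1?ltNge ?au//.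
  by apply/andP; split; lra.
have [tp|tp] := leP t pi; first exact: H.
have -> : cos t = cos (2 * pi - t).
  by rewrite -(cosN t) -(cosD2pi (- t)); congr cos; rewrite mulr2n; lra.
by apply: H; lra.
Qed.

(* A discrete Fejer mean: [p] averages the values of [f] at n + 1 nodes against
   nonnegative weights of sum 1 (whence the bound by [C] on the whole line), and
   the first cosine moment [Kc] of the weights makes them concentrate near [x]. *)
Lemma trig_approx (f : R -> R) (C M e : R) :
  continuous f -> (forall x, `|f x| <= C) -> 0 < e ->
  exists g, [/\ trig g, forall x, normc (g x) <= C &
    forall x, `|x| <= M -> normc (g x - (f x)%:C%C) <= e].
Proof.
move=> cf fC e0.
have C0 : 0 <= C by apply: le_trans (fC 0).
pose M1 := `|M| + 1.
have M10 : 0 < M1 by rewrite ltr_wpDl.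
have M1n : M1 != 0 by rewrite gt_eqF.
have e20 : 0 < e / 2 by rewrite divr_gt0.
have [d d0 hd] := uniform_continuity_segment M1 cf e20.
(* Angles closer than [a] correspond to points closer than [d] after rescaling by [M1]; the cap at 1
   is the one asked by [cos_le_far]. *)
pose a := Num.min (d / M1) 1.
have a0 : 0 < a by rewrite /a lt_min ltr01 divr_gt0.
have a1 : a <= 1 by rewrite /a ge_min lexx orbT.
have c0 : 0 < 1 - cos a.
  rewrite subr_gt0 -cos0 ltr_cos ?in_itv//= ?lexx ?pi_ge0//.
  by have p2 := pi_ge2 R; apply/andP; split; lra.
pose n := (Num.truncn (4 * C / ((1 - cos a) * e))).+1.
have n0 : 0 < n%:R :> R by rewrite ltr0n.
have nn0 : n%:R != 0 :> R by rewrite gt_eqF.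
have nS0 : n.+1%:R != 0 :> R by rewrite pnatr_eq0.
have nbig : 2 * C / (1 - cos a) / n%:R <= e / 2.
  rewrite ler_pdivrMr// -ler_pdivrMl//.
  have := truncnS_gt (4 * C / ((1 - cos a) * e)); rewrite -/n => /ltW.
  apply: le_trans; rewrite le_eqVlt; apply/orP; left; apply/eqP.
  by field; rewrite !gt_eqF.
pose t (j : nat) : R := pi - 2 * pi * j%:R / n.+1%:R.
pose c : R := (n%:R * n.+1%:R)^-1.
have cc0 : 0 < c by rewrite /c invr_gt0 mulr_gt0// ltr0n.
pose K (j : nat) (x : R) := c * fejer n (x / M1 - t j).
have K0 j x : 0 <= K j x by rewrite /K mulr_ge0 ?fejer_ge0// ltW.
have K1 x : \sum_(j < n.+1) K j x = 1.
  by rewrite -mulr_sumr sum_fejer_nodes mulVf// mulf_neq0.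
have Kc x : \sum_(j < n.+1) K j x * (1 - cos (x / M1 - t j)) = n%:R^-1.
  under eq_bigr do rewrite mulrBr mulr1.
  rewrite sumrB K1.
  under eq_bigr do rewrite /K -mulrA.
  rewrite -mulr_sumr sum_fejer_cos_nodes /c /n /=; set m := Num.truncn _.
  have : m.+1%:R != 0 :> R by rewrite pnatr_eq0.
  have : m.+2%:R != 0 :> R by rewrite pnatr_eq0.
  rewrite -(@natr1 _ m.+1) -(@natr1 _ m) => h1 h2; field.
  by rewrite h1 h2.
pose y j := t j * M1.
pose p x := \sum_(j < n.+1) f (y j) * K j x.
exists (fun x => (p x)%:C%C); split.
- have -> : (fun x => (p x)%:C%C) = (fun x => \sum_(j < n.+1) (f (y j) * c)%:C%C *
     \sum_(k < n) \sum_(l < n) expi (- ((k%:Z - l%:Z)%:~R * t j)) *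
        expi (((k%:Z - l%:Z)%:~R / M1) * x)).
    apply/funext => x; rewrite /p raddf_sum; apply: eq_bigr => j _ /=.
    rewrite /K mulrA rmorphM/= fejerE; congr (_ * _).
    apply: eq_bigr => k _; apply: eq_bigr => l _; rewrite -expiD; congr expi.
    by rewrite mulrBr addrC mulrAC mulrA.
  apply: trig_sum => j; apply: trigZ; apply: trig_sum => k; apply: trig_sum => l.
  exact: trig_expi.
- move=> x; rewrite normcR.
  apply: (le_trans (ler_norm_sum _ _ _)); rewrite -[leRHS]mulr1 -(K1 x) mulr_sumr.
  by apply: ler_sum => j _; rewrite normrM (ger0_norm (K0 _ _)) ler_wpM2r.
- move=> x xM; rewrite -rmorphB normcR.
  have -> : p x - f x = \sum_(j < n.+1) (f (y j) - f x) * K j x.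
    under [RHS]eq_bigr do rewrite mulrBl.
    by rewrite sumrB -mulr_sumr K1 mulr1.
  apply: (le_trans (ler_norm_sum _ _ _)).
  (* A Chebyshev bound: near nodes cost e / 2 by uniform continuity, and at far nodes 2 C is at most
     2 C (1 - cos s) / (1 - cos a), whose weighted sum [Kc] makes of order 1 / n. *)
  apply: (@le_trans _ _ (\sum_(j < n.+1) (e / 2 * K j x +
     2 * C / (1 - cos a) * (K j x * (1 - cos (x / M1 - t j)))))).
    apply: ler_sum => j _; rewrite normrM (ger0_norm (K0 _ _)).
    rewrite (_ : _ + _ = (e / 2 + 2 * C / (1 - cos a) * (1 - cos (x / M1 - t j))) * K j x).
      2: by ring.
    rewrite ler_wpM2r//.
    have [far|near] := leP a `|x / M1 - t j|; last first.
      have : `|f x - f (y j)| < e / 2.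
        apply: hd; first by apply: le_trans xM _; rewrite /M1 lerDl ler01 || (have := ler_norm M; rewrite /M1; lra).
        have -> : x - y j = (x / M1 - t j) * M1 by rewrite [RHS]mulrBl mulfVK.
        rewrite normrM (gtr0_norm M10) -ltr_pdivlMr//.
        by apply: lt_le_trans near _; rewrite /a ge_min lexx.
      rewrite distrC => /ltW h; apply: le_trans h _; rewrite lerDl.
      by rewrite mulr_ge0 ?divr_ge0 ?mulr_ge0// ?(ltW c0)// subr_ge0 cos_le1.
    apply: (@le_trans _ _ (2 * C)).
      by apply: (le_trans (ler_normB _ _)); have := fC (y j); have := fC x; lra.
    apply: (@le_trans _ _ (2 * C / (1 - cos a) * (1 - cos a))).
      by rewrite mulfVK// gt_eqF.
    apply: (@le_trans _ _ (2 * C / (1 - cos a) * (1 - cos (x / M1 - t j)))).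
      rewrite ler_wpM2l ?divr_ge0 ?mulr_ge0// ?(ltW c0)// lerB// (cos_le_far a0 a1 far)//.
      apply: (le_trans (ler_normB _ _)); rewrite addrC lerD//.
        rewrite /t ler_norml; have p0 := pi_gt0 R.
        have : 0 <= 2 * pi * j%:R / n.+1%:R :> R by rewrite divr_ge0// mulr_ge0// mulr_ge0// ltW.
        have : 2 * pi * j%:R / n.+1%:R <= 2 * pi :> R.
          by rewrite ler_pdivrMr ?ltr0n// ler_pM2l ?mulr_gt0// ler_nat ltnW.
        by move: (2 * pi * j%:R / n.+1%:R) => z *; apply/andP; split; lra.
      rewrite normrM normfV (gtr0_norm M10) ler_pdivrMr// mul1r.
      by apply: (le_trans xM); have := ler_norm M; rewrite /M1; lra.
    by rewrite lerDr ltW.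
  rewrite big_split/= -mulr_sumr K1 mulr1 -mulr_sumr Kc; move: nbig; lra.
Qed.
End trigonometric_approximation.

(** * Positive functionals and Levy's continuity theorem *)

Section cutoffs.
Context {R : realType}.
Implicit Types (a h t x M : R).

(** Truncation to [0, 1], written with absolute values so that its continuity is that of the
    norm. *)
Definition clamp t : R := (`|t| - `|t - 1| + 1) / 2.

Lemma clamp0 t : t <= 0 -> clamp t = 0.
Proof. by move=> t0; rewrite /clamp !ler0_norm; lra. Qed.

Lemma clamp1 t : 1 <= t -> clamp t = 1.
Proof. by move=> t0; rewrite /clamp !ger0_norm; lra. Qed.

Lemma clamp_id t : 0 <= t <= 1 -> clamp t = t.
Proof. by move=> /andP[t0 t1]; rewrite /clamp ger0_norm// ler0_norm; lra. Qed.

Lemma clamp_itv t : 0 <= clamp t <= 1.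
Proof.
have [t0|t0] := leP t 0; first by rewrite clamp0// lexx ler01.
have [t1|t1] := leP 1 t; first by rewrite clamp1// lexx ler01.
by rewrite clamp_id ltW//= ltW.
Qed.

Lemma clamp_ge0 t : 0 <= clamp t. Proof. by case/andP: (clamp_itv t). Qed.
Lemma clamp_le1 t : clamp t <= 1. Proof. by case/andP: (clamp_itv t). Qed.

Lemma continuous_clamp (f : R -> R) : continuous f -> continuous (clamp \o f).
Proof.
move=> cf x; rewrite /clamp/=; apply: cvgM; last exact: cvg_cst.
apply: cvgD; last exact: cvg_cst.
apply: cvgB; apply: cvg_norm; first exact: cf.
by apply: cvgB; [exact: cf|exact: cvg_cst].
Qed.

(* Bounded and continuous. *)
Definition BC (f : R -> R) := continuous f /\ exists C, forall x, `|f x| <= C.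

Lemma BC_cst (c : R) : BC (fun=> c).
Proof. by split; [move=> x; exact: cvg_cst|exists `|c|]. Qed.

Lemma BC_clamp (f : R -> R) : continuous f -> BC (fun x => clamp (f x)).
Proof.
move=> cf; split; first exact: continuous_clamp.
by exists 1 => x; rewrite ger0_norm ?clamp_ge0 ?clamp_le1.
Qed.

Lemma BCD (f g : R -> R) : BC f -> BC g -> BC (fun x => f x + g x).
Proof.
move=> [cf [C fC]] [cg [D gD]]; split.
  by move=> x; apply: cvgD; [exact: cf|exact: cg].
by exists (C + D) => x; apply: (le_trans (ler_normD _ _)); rewrite lerD.
Qed.

Lemma BCZ c (f : R -> R) : BC f -> BC (fun x => c * f x).
Proof.
move=> [cf [C fC]]; split.
  by move=> x; apply: cvgM; [exact: cvg_cst|exact: cf].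
by exists (`|c| * C) => x; rewrite normrM ler_wpM2l.
Qed.

(* Continuous, nonincreasing, equal to 1 on ]-oo, a] and to 0 on [a + h, +oo[. *)
Definition ramp a h x : R := clamp ((a + h - x) / h).

Lemma BC_ramp a h : BC (ramp a h).
Proof.
apply: BC_clamp => x; apply: cvgM; last exact: cvg_cst.
by apply: cvgB; [exact: cvg_cst|exact: cvg_id].
Qed.

Lemma ramp1 a h x : 0 < h -> x <= a -> ramp a h x = 1.
Proof. by move=> h0 xa; apply: clamp1; rewrite ler_pdivlMr//; lra. Qed.

Lemma ramp0 a h x : 0 < h -> a + h <= x -> ramp a h x = 0.
Proof. by move=> h0 xa; apply: clamp0; rewrite ler_pdivrMr//; lra. Qed.

Lemma ramp_ge0 a h x : 0 <= ramp a h x. Proof. exact: clamp_ge0. Qed.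
Lemma ramp_le1 a h x : ramp a h x <= 1. Proof. exact: clamp_le1. Qed.

Lemma ramp_le a h b k x : 0 < h -> 0 < k -> a + h <= b -> ramp a h x <= ramp b k x.
Proof.
move=> h0 k0 ab; have [xb|xb] := leP x b; first by rewrite (ramp1 k0 xb) ramp_le1.
by rewrite ramp0 ?ramp_ge0//; lra.
Qed.

(* Detects escaping mass: 0 on [-M, M] and 1 outside [-M - 1, M + 1]. *)
Definition cut M x : R := clamp (`|x| - M).

Lemma BC_cut M : BC (cut M).
Proof.
apply: BC_clamp => x; apply: cvgB; last exact: cvg_cst.
by apply: cvg_norm; exact: cvg_id.
Qed.

Lemma cut_ge0 M x : 0 <= cut M x. Proof. exact: clamp_ge0. Qed.
Lemma cut_le1 M x : cut M x <= 1. Proof. exact: clamp_le1. Qed.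

Lemma cut1 M x : M + 1 <= `|x| -> cut M x = 1.
Proof. by move=> xM; apply: clamp1; lra. Qed.

Lemma cut0 M x : `|x| <= M -> cut M x = 0.
Proof. by move=> xM; apply: clamp0; lra. Qed.

Lemma cut_ramp M x : 0 <= M -> cut M x = ramp (- M - 1) 1 x + (1 - ramp M 1 x).
Proof.
move=> M0; rewrite /cut /ramp !divr1.
have [x0|x0] := leP 0 x.
  rewrite ger0_norm// (@clamp0 (- M - 1 + 1 - x)); last lra.
  have [h1|h1] := leP x M; first by rewrite clamp0 ?clamp1; lra.
  have [h2|h2] := leP (M + 1) x; first by rewrite clamp1 ?clamp0; lra.
  by rewrite !clamp_id; lra.
rewrite ltr0_norm// (@clamp1 (M + 1 - x)); last lra.
have [h1|h1] := leP (- x) M; first by rewrite clamp0 ?clamp0; lra.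
have [h2|h2] := leP (M + 1) (- x); first by rewrite clamp1 ?clamp1; lra.
by rewrite !clamp_id; lra.
Qed.

End cutoffs.

(** * Positive functionals compared through a distribution function *)

Section positive_functionals.
Context {R : realType}.
Implicit Types (f g : R -> R) (L : (R -> R) -> R).

(** The laws are asked on bounded continuous functions only, so that finite averages, integrals
    against a probability measure and limits of averages all qualify. *)
Record posfun L : Prop := PosFun {
  posfunD : forall f g, BC f -> BC g -> L (fun x => f x + g x) = L f + L g ;
  posfunZ : forall c f, BC f -> L (fun x => c * f x) = c * L f ;
  posfun_le : forall f g, BC f -> BC g -> (forall x, f x <= g x) -> L f <= L g ;
  posfun1 : L (fun=> 1) = 1 }.

Lemma posfun_cst L c : posfun L -> L (fun=> c) = c.
Proof.
move=> pL; rewrite -[RHS]mulr1 -(posfun1 pL) -(posfunZ pL); last exact: BC_cst.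
by congr L; apply/funext => x; rewrite mulr1.
Qed.

Lemma posfun_dist L f g k : posfun L -> BC f -> BC g -> BC k ->
  (forall x, `|f x - g x| <= k x) -> `|L f - L g| <= L k.
Proof.
move=> pL bf bg bk H.
have h1 : L f <= L (fun x => g x + k x).
  by apply: (posfun_le pL) => //; [exact: BCD|move=> x; have := H x; rewrite ler_norml; lra].
have h2 : L g <= L (fun x => f x + k x).
  by apply: (posfun_le pL) => //; [exact: BCD|move=> x; have := H x; rewrite ler_norml; lra].
move: h1 h2; rewrite !(posfunD pL)// ler_norml; lra.
Qed.

(* Piecewise linear interpolation of [f] at the nodes [y i], written with ramps so
   that a positive functional on it only sees the distribution function. *)
Definition interp f (y : nat -> R) h (K : nat) x : R :=
  f (y 0%N) + \sum_(i < K) (f (y i.+1) - f (y i)) * (1 - ramp (y i) h x).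

Lemma interpS f y h K x : interp f y h K.+1 x =
  interp f y h K x + (f (y K.+1) - f (y K)) * (1 - ramp (y K) h x).
Proof. by rewrite /interp big_ord_recr/= addrA. Qed.

(** Induction on the number of cells: past its last node the interpolant is constant, so a new ramp
    acts only on the new cell. There the old value is within [e] of [f x], and the partial jump adds
    at most [e]. *)
Lemma interp_approx f (a h e : R) K : 0 < h -> 0 <= e ->
  let y i := a + i%:R * h in
  (forall i x, (i < K)%N -> y i <= x -> x <= y i.+1 -> `|f (y i) - f x| <= e) ->
  [/\ forall x, x <= a -> interp f y h K x = f a,
      forall x, y K <= x -> interp f y h K x = f (y K) &
      forall x, a <= x -> x <= y K -> `|interp f y h K x - f x| <= 2 * e].
Proof.
move=> h0 e0 y.
have yS i : y i.+1 = y i + h by rewrite /y -natr1 mulrDl mul1r addrA.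
have y0 : y 0%N = a by rewrite /y mul0r addr0.
have ay i : a <= y i by rewrite /y lerDl mulr_ge0// ltW.
elim: K => [|K IH] He.
  have E x : interp f y h 0 x = f a by rewrite /interp big_ord0 addr0 y0.
  split=> [x _|x _|x]; rewrite ?E ?y0// => ax xa.
  have -> : x = a by apply/le_anti; rewrite ax xa.
  by rewrite subrr normr0 mulr_ge0.
have [|h1 h2 h3] := IH; first by move=> i x iK; apply: He; exact: ltnW.
split=> [x xa|x xy|x ax xy]; rewrite interpS.
- by rewrite ramp1// ?subrr ?mulr0 ?addr0 ?h1//; apply: le_trans xa (ay _).
- rewrite ramp0// -?yS// subr0 mulr1 h2 1?addrC ?subrK//.
  by apply: le_trans xy; rewrite yS lerDl ltW.
- have [xK|xK] := leP x (y K); first by rewrite ramp1// subrr mulr0 addr0 h3.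
  rewrite (h2 _ (ltW xK)).
  have := He K x (leqnn _) (ltW xK) xy.
  have := He K (y K.+1) (leqnn _); rewrite yS lerDl ltW// lexx => /(_ isT isT).
  have := ramp_ge0 (y K) h x; have := ramp_le1 (y K) h x.
  move: (ramp _ _ _) => r r1 r0 b1 b2.
  rewrite addrAC; apply: (le_trans (ler_normD _ _)).
  rewrite normrM [in leRHS](_ : 2 * e = e + e * 1); last by rewrite mulr1 mulr2n mulrDl mul1r.
  have n1 : `|1 - r| <= 1 by rewrite ger0_norm; lra.
  by rewrite lerD//; apply: ler_pM => //; rewrite distrC.
Qed.

Lemma BC_interp f y h K : BC (interp f y h K).
Proof.
elim: K => [|K IH].
  rewrite (_ : interp _ _ _ _ = fun=> f (y 0%N)); first exact: BC_cst.
  by apply/funext => x; rewrite /interp big_ord0 addr0.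
rewrite (_ : interp _ _ _ _ = fun x => interp f y h K x + (f (y K.+1) - f (y K)) * (1 + -1 * ramp (y K) h x)).
  by apply: BCD => //; apply/BCZ/BCD; [exact: BC_cst|exact/BCZ/BC_ramp].
by apply/funext => x; rewrite interpS mulN1r.
Qed.

Lemma posfun_interp L f y h K : posfun L -> L (interp f y h K) =
  f (y 0%N) + \sum_(i < K) (f (y i.+1) - f (y i)) * (1 - L (ramp (y i) h)).
Proof.
move=> pL; elim: K => [|K IH].
  rewrite (_ : interp _ _ _ _ = fun=> f (y 0%N)).
    by rewrite posfun_cst// big_ord0 addr0.
  by apply/funext => x; rewrite /interp big_ord0 addr0.
rewrite (_ : interp _ _ _ _ = fun x => interp f y h K x + (f (y K.+1) - f (y K)) * (1 + -1 * ramp (y K) h x)).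
  have bB : BC (fun x => 1 + -1 * ramp (y K) h x).
    by apply: BCD; [exact: BC_cst|exact/BCZ/BC_ramp].
  rewrite (posfunD pL); [|exact: BC_interp|exact: BCZ].
  rewrite (posfunZ pL (f (y K.+1) - f (y K)) bB).
  rewrite (posfunD pL (BC_cst 1) (BCZ (-1) (BC_ramp (y K) h))).
  rewrite posfun1// (posfunZ pL _ (BC_ramp _ _)).
  by rewrite IH big_ord_recr/= addrA mulN1r.
by apply/funext => x; rewrite interpS mulN1r.
Qed.

(** The strict [a' < a] makes the lower bound immediate for [dfun], an infimum over ramps that start
    strictly to the right of its argument. *)
Definition distribution_bounds L (F : R -> R) := forall a' a h, a' < a -> 0 < h ->
  F a' <= L (ramp a h) <= F (a + h).

Definition distribution_fun (F : R -> R) := [/\ {homo F : x y / x <= y},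
  forall a, 0 <= F a <= 1, forall e, 0 < e -> exists a, F a <= e &
  forall e, 0 < e -> exists a, 1 - e <= F a].

Lemma posfun_cut L F e : posfun L -> distribution_bounds L F -> distribution_fun F ->
  0 < e -> exists2 M0, 0 <= M0 & forall M, M0 <= M -> L (cut M) <= e.
Proof.
move=> pL LF [Fnd F01 FN Fy] e0.
have [a1 h1] := FN (e / 2) (divr_gt0 e0 (ltr0n _ 2)).
have [a2 h2] := Fy (e / 2) (divr_gt0 e0 (ltr0n _ 2)).
exists (`|a1| + `|a2| + 1); first by rewrite !addr_ge0.
move=> M hM.
have n1 : 0 <= `|a1| by []. have n2 : 0 <= `|a2| by [].
have M0 : 0 <= M by lra.
rewrite (_ : cut M = fun x => ramp (- M - 1) 1 x + (1 + -1 * ramp M 1 x)); last first.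
  by apply/funext => x; rewrite cut_ramp// mulN1r.
have bB : BC (fun x => 1 + -1 * ramp M 1 x).
  by apply: BCD; [exact: BC_cst|exact/BCZ/BC_ramp].
rewrite (posfunD pL)//; last exact: BC_ramp.
rewrite (posfunD pL); [|exact: BC_cst|exact/BCZ/BC_ramp].
rewrite posfun1// (posfunZ pL) ?mulN1r; last exact: BC_ramp.
have /andP[_ u1] := LF (- M - 2) (- M - 1) 1 ltac:(lra) ltr01.
have /andP[u2 _] := LF (M - 1) M 1 ltac:(lra) ltr01.
have v1 : F (- M - 1 + 1) <= F a1.
  by apply: Fnd; have := ler_norm (- a1); rewrite normrN; lra.
have v2 : F a2 <= F (M - 1) by apply: Fnd; have := ler_norm a2; lra.
lra.
Qed.

(** Each increment spans two cells, so telescoping leaves two terms at either end. For [F] with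
    values in [0, 1] the total is at most 2, whatever [K]. *)
Lemma sum_step_differences (F : R -> R) a h K :
  \sum_(i < K) (F (a + i%:R * h + h) - F (a + i%:R * h - h)) =
  F (a + K%:R * h) + F (a + K%:R * h - h) - F a - F (a - h).
Proof.
elim: K => [|K IH]; first by rewrite big_ord0 mul0r addr0; ring.
rewrite big_ord_recr/= IH.
have -> : a + K.+1%:R * h = a + K%:R * h + h by rewrite -natr1; ring.
by rewrite addrK; ring.
Qed.

(* The functionals differ on each ramp by at most an increment of [F], and these
   increments are summable: hence an interpolant of oscillation [e] sees a
   difference of order [e] uniformly in the number of nodes. *)
Lemma posfun_unique L1 L2 F f : posfun L1 -> posfun L2 ->
  distribution_bounds L1 F -> distribution_bounds L2 F -> distribution_fun F ->
  BC f -> L1 f = L2 f.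
Proof.
move=> pL1 pL2 L1F L2F dF bf; have [cf [C fC]] := bf.
have C0 : 0 <= C by apply: le_trans (fC 0).
suff H e : 0 < e -> e <= 1 -> `|L1 f - L2 f| <= e * (8 * C + 14).
  apply/eqP; rewrite -subr_eq0 -normr_le0 leNgt; apply/negP => d0.
  pose A := 8 * C + 15.
  have A0 : 0 < A by rewrite /A; lra.
  (* [A] exceeds the constant of [H] by one, so for this [e] the bound [H] falls strictly below the
     difference it should dominate. *)
  pose e := Num.min 1 (`|L1 f - L2 f| / A).
  have e0 : 0 < e by rewrite /e lt_min ltr01 divr_gt0.
  have := H e e0; rewrite /e ge_min lexx => /(_ isT); rewrite -/e => h.
  have : e * A <= `|L1 f - L2 f| by rewrite -ler_pdivlMr// /e ge_min lexx orbT.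
  by move: h; rewrite /A; nra.
move=> e0 e1.
have [M1 M10 c1] := posfun_cut pL1 L1F dF e0.
have [M2 M20 c2] := posfun_cut pL2 L2F dF e0.
pose M := M1 + M2.
have {}c1 : L1 (cut M) <= e by apply: c1; rewrite lerDl.
have {}c2 : L2 (cut M) <= e by apply: c2; rewrite lerDr.
have M0 : 0 <= M by rewrite addr_ge0.
have [d d0 hd] := uniform_continuity_segment (M + 1) cf e0.
pose h := d / 2; have h0 : 0 < h by rewrite divr_gt0.
have hltd : h < d by rewrite /h ltr_pdivrMr// ltr_pMr// ltr1n.
pose a := - (M + 1).
pose K := (Num.truncn (2 * (M + 1) / h)).+1.
pose y i := a + i%:R * h.
have yK : M + 1 <= y K.
  have : 2 * (M + 1) / h < K%:R by rewrite /K truncnS_gt.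
  by rewrite ltr_pdivrMr// /y /a; lra.
have yin i : (i < K)%N -> `|y i| <= M + 1.
  rewrite /K ltnS => iK.
  have : (i%:R : R) <= 2 * (M + 1) / h.
    apply: le_trans (_ : (Num.truncn (2 * (M + 1) / h))%:R <= _); first by rewrite ler_nat.
    by rewrite truncn_le divr_ge0//; [lra|exact: ltW].
  rewrite ler_pdivlMr// => ih; rewrite ler_norml /y /a.
  have : 0 <= i%:R * h by rewrite mulr_ge0// ltW.
  by move: ih; move: (i%:R * h) => z *; apply/andP; split; lra.
have yS i : y i.+1 = y i + h by rewrite /y -natr1 mulrDl mul1r addrA.
have osc i x : (i < K)%N -> y i <= x -> x <= y i.+1 -> `|f (y i) - f x| <= e.
  move=> iK yx xy; apply/ltW/hd; first exact: yin.
  by rewrite ler0_norm; move: xy; rewrite ?yS; lra.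
have [g1 g2 g3] := interp_approx h0 (ltW e0) osc.
set g := interp f _ h K in g1 g2 g3.
have bg : BC g by exact: BC_interp.
pose k x := 2 * e + (2 * C) * cut M x.
have bk : BC k by apply: BCD; [exact: BC_cst|exact/BCZ/BC_cut].
have fg x : `|f x - g x| <= k x.
  have kk : 2 * e <= k x by rewrite /k lerDl mulr_ge0 ?cut_ge0// mulr_ge0.
  have big z : M + 1 <= `|x| -> `|f x - f z| <= k x.
    move=> xM; rewrite /k cut1// mulr1; apply: (le_trans (ler_normB _ _)).
    by have := fC x; have := fC z; lra.
  have [xa|xa] := leP x a.
    by rewrite g1//; apply: big; rewrite ler0_norm; rewrite /a in xa; lra.
  have [xK|xK] := leP (y K) x.
    by rewrite g2//; apply: big; rewrite ger0_norm; lra.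
  by rewrite distrC; apply: le_trans kk; apply: g3; exact: ltW.
have Lk L : posfun L -> L (cut M) <= e -> L k <= (2 + 2 * C) * e.
  move=> pL cL; rewrite /k (posfunD pL); [|exact: BC_cst|exact/BCZ/BC_cut].
  rewrite posfun_cst// (posfunZ pL); last exact: BC_cut.
  have : 2 * C * L (cut M) <= 2 * C * e by rewrite ler_wpM2l// mulr_ge0.
  lra.
have e1' := posfun_dist pL1 bf bg bk fg.
have e2' := posfun_dist pL2 bf bg bk fg.
have := Lk _ pL1 c1; have := Lk _ pL2 c2 => k2 k1.
suff gg : `|L1 g - L2 g| <= 2 * e.
  have t1 := ler_distD (L1 g) (L1 f) (L2 f).
  have t2 := ler_distD (L2 g) (L1 g) (L2 f).
  by move: t1 t2; rewrite (distrC (L2 g)); nra.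
have [Fnd F01 _ _] := dF.
have E (u v w : R) : (u + v) - (u + w) = v - w by ring.
rewrite /g !posfun_interp// E -sumrB.
apply: (le_trans (ler_norm_sum _ _ _)).
apply: (@le_trans _ _ (\sum_(i < K) e * (F (y i + h) - F (y i - h)))).
  apply: ler_sum => i _; rewrite -mulrBr normrM ler_pM//.
    by rewrite distrC; apply: (osc i (y i.+1)) => //; rewrite yS lerDl ltW.
  have /andP[u1 u2] := L1F (y i - h) (y i) h ltac:(lra) h0.
  have /andP[u3 u4] := L2F (y i - h) (y i) h ltac:(lra) h0.
  by rewrite -/(y i) ler_norml; apply/andP; split; lra.
rewrite -mulr_sumr sum_step_differences mulrC ler_wpM2r ?(ltW e0)//.
have := F01 (a + K%:R * h); have := F01 (a + K%:R * h - h).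
have := F01 a; have := F01 (a - h); lra.
Qed.

End positive_functionals.

Section levy.
Context {R : realType}.

Lemma approx_cvgn (u : nat -> R) :
  (forall e, 0 < e -> exists2 w : nat -> R, cvgn w & \forall m \near \oo, `|u m - w m| <= e) ->
  cvgn u.
Proof.
move=> H; apply/cauchy_cvgP/cauchy_exP => e e0.
have e4 : 0 < e / 4 by rewrite divr_gt0.
have [w cw uw] := H _ e4.
exists (limn w).
suff : \forall m \near \oo, `|limn w - u m| < e by [].
near=> m.
have h1 : `|u m - w m| <= e / 4 by near: m.
have h2 : `|limn w - w m| < e / 4 by near: m; move/cvgrPdist_lt: cw; exact.
have := ler_distD (w m) (limn w) (u m); rewrite (distrC (w m)); lra.
Unshelve. all: end_near. Qed.

Lemma posfun_avg (s : seq R) : (0 < size s)%N -> posfun (avg s).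
Proof.
move=> s0; split.
- by move=> f g _ _; exact: avgD.
- by move=> c f _; exact: avgZ.
- by move=> f g _ _ fg; apply: ler_avg => x _; exact: fg.
- exact: avg_cst.
Qed.

Lemma posfun_lim (L : nat -> (R -> R) -> R) : (forall n, posfun (L n)) ->
  (forall f, BC f -> cvgn (fun n => L n f)) -> posfun (fun f => limn (fun n => L n f)).
Proof.
move=> pL cL; split.
- move=> f g bf bg; under eq_fun do rewrite (posfunD (pL _) bf bg).
  by apply: limD; exact: cL.
- move=> c f bf; under eq_fun do rewrite (posfunZ (pL _) _ bf).
  by apply/cvg_lim => //; apply: cvgMr; exact: cL.
- move=> f g bf bg fg; apply: ler_lim; [exact: cL|exact: cL|].
  by apply: nearW => n; exact: (posfun_le (pL n)).
- by under eq_fun do rewrite (posfun1 (pL _)); rewrite lim_cst.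
Qed.

Lemma integrable_BC (nu : borel_prob R) (f : R -> R) : BC f ->
  nu.-integrable setT (EFin \o (f : measurableTypeR R -> R)).
Proof.
move=> [cf [C fC]].
apply: measurable_bounded_integrable => //.
- by rewrite -ge0_fin_numE// fin_num_measure.
- exact: continuous_measurable_fun.
- by exists C; split; [exact: num_real|move=> z Cz x _; apply: le_trans (fC x) _; exact: ltW].
Qed.

Lemma posfun_integral (nu : borel_prob R) : posfun (fun f => \int[nu]_x f x).
Proof.
split.
- by move=> f g bf bg; rewrite RintegralD//; exact: integrable_BC.
- by move=> c f bf; rewrite RintegralZl//; exact: integrable_BC.
- by move=> f g bf bg fg; apply: le_Rintegral => //; exact: integrable_BC.
- by rewrite Rintegral_cst// mul1r; exact: (congr1 fine (probability_setT nu)).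
Qed.

Lemma Rintegral_indic (nu : borel_prob R) (A : set (measurableTypeR R)) :
  measurable A -> \int[nu]_x \1_A x = fine (nu A).
Proof. by move=> mA; rewrite /Rintegral integral_indic// setIT. Qed.

(** * The distribution function of a tight positive functional *)

Section distribution_function.
Variables (L : (R -> R) -> R) (pL : posfun L).
Hypothesis tight : forall e, 0 < e -> exists2 M, 0 <= M & L (cut M) <= e.

(* The infimum over [b > a], not over [b >= a], is what makes [dfun] right continuous. *)
Definition dfun (a : R) : R := inf [set z | exists b h, [/\ a < b, 0 < h & z = L (ramp b h)]].

Let dfun_set_ge0 a z : [set z | exists b h, [/\ a < b, 0 < h & z = L (ramp b h)]] z -> 0 <= z <= 1.
Proof.
move=> [b [h [_ _ ->]]]; apply/andP; split.
  by rewrite -(posfun_cst 0 pL); apply: (posfun_le pL); [exact: BC_cst|exact: BC_ramp|move=> x; exact: ramp_ge0].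
by rewrite -(posfun1 pL); apply: (posfun_le pL); [exact: BC_ramp|exact: BC_cst|move=> x; exact: ramp_le1].
Qed.

Let has_inf_dfun a : has_inf [set z | exists b h, [/\ a < b, 0 < h & z = L (ramp b h)]].
Proof.
split; first by exists (L (ramp (a + 1) 1)); exists (a + 1), 1; rewrite ltrDl.
by exists 0 => z /dfun_set_ge0/andP[].
Qed.

Lemma dfun_le a b h : a < b -> 0 < h -> dfun a <= L (ramp b h).
Proof.
by move=> ab h0; apply: ge_inf; [exact: (has_inf_dfun a).2|exists b, h].
Qed.

Lemma le_dfun a h : 0 < h -> L (ramp a h) <= dfun (a + h).
Proof.
move=> h0; apply: lb_le_inf; first exact: (has_inf_dfun _).1.
move=> z [b [k [ab k0 ->]]]; apply: (posfun_le pL); [exact: BC_ramp|exact: BC_ramp|].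
by move=> x; apply: ramp_le => //; exact: ltW.
Qed.

Lemma dfun_bounds : distribution_bounds L dfun.
Proof. by move=> a' a h a'a h0; rewrite dfun_le// le_dfun. Qed.

Lemma dfun_itv a : 0 <= dfun a <= 1.
Proof.
apply/andP; split.
  apply: lb_le_inf; first exact: (has_inf_dfun _).1.
  by move=> z /dfun_set_ge0/andP[].
apply: (@le_trans _ _ (L (ramp (a + 1) 1))); first by apply: dfun_le; rewrite ?ltrDl.
rewrite -(posfun1 pL); apply: (posfun_le pL); [exact: BC_ramp|exact: BC_cst|].
by move=> x; exact: ramp_le1.
Qed.

Lemma dfun_nd : {homo dfun : x y / x <= y}.
Proof.
move=> x y xy; apply: lb_le_inf; first exact: (has_inf_dfun _).1.
by move=> z [b [k [yb k0 ->]]]; apply: dfun_le => //; exact: le_lt_trans xy yb.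
Qed.

Lemma dfun_tail e : 0 < e -> exists2 M0, 0 <= M0 &
  forall a, M0 <= a -> dfun (- a) <= e /\ 1 - e <= dfun a.
Proof.
(* The margin 3 leaves room for a ramp that starts strictly to the right of [- a] and vanishes from
   - M - 1 on, where the left ramp of [cut M] begins to decrease. *)
move=> e0; have [M M0 cM] := tight e0; exists (M + 3); first lra.
move=> a Ma; split.
  apply: le_trans cM; apply: le_trans (dfun_le (b := - M - 2) (h := 1) _ _) _ => //; first lra.
  apply: (posfun_le pL); [exact: BC_ramp|exact: BC_cut|move=> x].
  rewrite cut_ramp//; apply: ler_wpDr; first by have := ramp_le1 M 1 x; lra.
  by apply: ramp_le => //; lra.
have : L (ramp (a - 1) 1) <= dfun (a - 1 + 1) := le_dfun _ ltr01.
rewrite subrK; apply: le_trans.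
rewrite lerBlDr addrC -lerBlDr; apply: le_trans cM.
have -> : 1 - L (ramp (a - 1) 1) = L (fun x => 1 + -1 * ramp (a - 1) 1 x).
  rewrite (posfunD pL (BC_cst 1) (BCZ (-1) (BC_ramp _ _))) posfun1//.
  by rewrite (posfunZ pL _ (BC_ramp _ _)) mulN1r.
apply: (posfun_le pL); [|exact: BC_cut|move=> x].
  by apply: BCD; [exact: BC_cst|exact/BCZ/BC_ramp].
rewrite mulN1r cut_ramp//; apply: ler_wpDl; first exact: ramp_ge0.
by rewrite lerD2l lerN2; apply: ramp_le => //; lra.
Qed.

Lemma dfun_distribution : distribution_fun dfun.
Proof.
split; [exact: dfun_nd|exact: dfun_itv| |] => e e0; have [M M0 H] := dfun_tail e0.
  by exists (- M); have [] := H M (lexx _).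
by exists M; have [] := H M (lexx _).
Qed.

Let dfun_rc : right_continuous dfun.
Proof.
move=> a; apply/cvgrPdist_le => e e0.
have [z [b [h [ab h0 ->]]] zlt] := inf_adherent e0 (has_inf_dfun a).
near=> x.
have ax : a <= x by near: x; exact: nbhs_right_ge.
have xb : x < b by near: x; exact: nbhs_right_lt.
rewrite ler0_norm ?subr_le0 ?dfun_nd// opprB lerBlDl.
by apply: le_trans (dfun_le xb h0) _; exact: ltW.
Unshelve. all: end_near. Qed.

HB.instance Definition _ := isCumulative.Build R _ R dfun dfun_nd dfun_rc.

Let dfun_Ny : dfun @ -oo --> (0 : R).
Proof.
apply/cvgrPdist_le => e e0; have [M M0 H] := dfun_tail e0.
near=> x; have xM : x <= - M by near: x; apply: nbhs_ninfty_le; rewrite num_real.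
have [] := H (- x) _; first by rewrite lerNr.
rewrite opprK sub0r normrN => h _; rewrite ger0_norm//.
by have /andP[] := dfun_itv x.
Unshelve. all: end_near. Qed.

Let dfun_y : dfun @ +oo --> (1 : R).
Proof.
apply/cvgrPdist_le => e e0; have [M M0 H] := dfun_tail e0.
near=> x; have xM : M <= x by near: x; apply: nbhs_pinfty_ge; rewrite num_real.
have [_ h] := H x xM; have /andP[_ h1] := dfun_itv x.
by rewrite ger0_norm; lra.
Unshelve. all: end_near. Qed.

HB.instance Definition _ := isCumulativeBounded.Build R 0 1 dfun dfun_Ny dfun_y.

Lemma stieltjes_dfun a : lebesgue_stieltjes_measure dfun `]-oo, a] = (dfun a)%:E.
Proof.
have := cdf_lebesgue_stieltjes_id dfun a.
by rewrite /cdf /distribution /pushforward /= preimage_id.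
Qed.

(** Existence follows from uniqueness: [L] and the integral against the Stieltjes measure of [dfun]
    satisfy the same [distribution_bounds], so [posfun_unique] identifies them. Tightness makes this
    measure a probability; it excludes a generalized limit at infinity, for which [dfun] is
    constant. *)
Lemma riesz_markov : exists nu : borel_prob R, forall f, BC f -> L f = \int[nu]_x f x.
Proof.
pose nu : borel_prob R := lebesgue_stieltjes_measure dfun.
exists nu => f bf.
apply: (posfun_unique pL (posfun_integral nu) dfun_bounds _ dfun_distribution bf).
move=> a' a h a'a h0.
have H b : dfun b = \int[nu]_x (\1_(`]-oo, b] : set (measurableTypeR R)) x).
  by rewrite Rintegral_indic// /nu /= stieltjes_dfun.
apply/andP; split; rewrite H; apply: le_Rintegral => //.
- exact: integrable_indic.
- exact/integrable_BC/BC_ramp.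
- move=> x _; rewrite indicE; case: (boolP (_ \in _)) => [|_]; last exact: ramp_ge0.
  by rewrite inE /= in_itv/= => xa'; rewrite ramp1//; apply: ltW; exact: le_lt_trans a'a.
- exact/integrable_BC/BC_ramp.
- exact: integrable_indic.
- move=> x _; rewrite indicE; case: (boolP (_ \in _)) => [_|]; first exact: ramp_le1.
  by rewrite notin_setE /= in_itv/= => /negP; rewrite -ltNge => xa; rewrite ramp0// ltW.
Qed.

End distribution_function.

Lemma trig_Re_cvgn (s_ : nat -> seq R) (g : R -> R[i]) :
  (forall w, cvgn (fun m => avg (s_ m) (fun x => cos (w * x)))) ->
  (forall w, cvgn (fun m => avg (s_ m) (fun x => sin (w * x)))) ->
  trig g -> cvgn (fun m => avg (s_ m) (fun x => complex.Re (g x))).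
Proof.
move=> hc hs [r hg].
rewrite (_ : (fun m => _) = fun m => \sum_(p <- r)
  (complex.Re p.1 * avg (s_ m) (fun x => cos (p.2 * x)) -
   complex.Im p.1 * avg (s_ m) (fun x => sin (p.2 * x)))); last first.
  apply/funext => m; under [RHS]eq_bigr do rewrite -!avgZ -avgN -avgD.
  rewrite -avg_sum; apply: eq_avg => x _; rewrite hg Re_sum.
  by apply: eq_bigr => -[[a b] w] _.
elim: r {hg} => [|p r IH].
  by under eq_fun do rewrite big_nil; exact: is_cvg_cst.
under eq_fun do rewrite big_cons.
apply: is_cvgD IH; apply: is_cvgB; apply: is_cvgM => //; exact: is_cvg_cst.
Qed.

(** Tightness replaces the usual continuity at 0 of the limit transform. It localizes a bounded
    continuous [f], whose averages are then followed up to [e] by those of a trigonometric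
    polynomial; [riesz_markov] represents the limit functional. *)
Lemma levy_continuity (s_ : nat -> seq R) : (forall m, (0 < size (s_ m))%N) ->
  (forall e, 0 < e -> exists2 M, 0 <= M & \forall m \near \oo, avg (s_ m) (cut M) <= e) ->
  (forall w, cvgn (fun m => avg (s_ m) (fun x => cos (w * x)))) ->
  (forall w, cvgn (fun m => avg (s_ m) (fun x => sin (w * x)))) ->
  exists nu : borel_prob R, forall f, BC f ->
    avg (s_ m) f @[m --> \oo] --> \int[nu]_x f x.
Proof.
move=> s0 tight hc hs.
have pa m : posfun (avg (s_ m)) by exact: posfun_avg.
have cv f : BC f -> cvgn (fun m => avg (s_ m) f).
  move=> bf; have [cf [C fC]] := bf; apply: approx_cvgn => e e0.
  have C0 : 0 <= C by apply: le_trans (fC 0).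
  (* Outside the window the error is at most 2 C times the average of [cut M], hence at most e / 2;
     the added 1 covers C = 0. *)
  have e1 : 0 < e / (4 * C + 1) by rewrite divr_gt0//; lra.
  have [M M0 cM] := tight _ e1.
  have [g [tg gC gf]] := trig_approx (M + 1) cf fC (divr_gt0 e0 (ltr0n _ 2)).
  exists (fun m => avg (s_ m) (fun x => complex.Re (g x))); first exact: trig_Re_cvgn.
  near=> m.
  have cMm : avg (s_ m) (cut M) <= e / (4 * C + 1) by near: m.
  rewrite avgB.
  apply: (@le_trans _ _ (avg (s_ m) (fun x => e / 2 + 2 * C * cut M x))).
    apply: (le_trans (ler_norm_avg _ _)); apply: ler_avg => x _.
    have gx : `|complex.Re (g x)| <= C by apply: le_trans (normc_Re _) _.
    have [xM|xM] := leP `|x| (M + 1).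
      apply: (@le_trans _ _ (e / 2)); last by rewrite lerDl mulr_ge0 ?cut_ge0// mulr_ge0.
      apply: le_trans (gf x xM); apply: le_trans (normc_Re _).
      by rewrite distrC; case: (g x) => a b /=.
    rewrite (cut1 (ltW xM)) mulr1; apply: (le_trans (ler_normB _ _)); have := fC x; lra.
  rewrite avgD (avgZ _ (2 * C)) avg_cst//.
  have : 2 * C * avg (s_ m) (cut M) <= 2 * C * (e / (4 * C + 1)) by rewrite ler_wpM2l// mulr_ge0.
  have : 2 * C * (e / (4 * C + 1)) <= e / 2.
    by rewrite mulrA ler_pdivrMr; nra.
  lra.
have [|nu hnu] := @riesz_markov _ (posfun_lim pa cv).
  move=> e e0; have [M M0 cM] := tight _ e0; exists M => //.
  by apply: limr_le; [exact/cv/BC_cut|].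
by exists nu => f bf; rewrite -hnu//; exact: cv.
Unshelve. all: end_near. Qed.

End levy.

(** * Fourier transforms of the convolutions and of their tails *)

Section symbols.
Context {R : realType}.

Definition symbol (B : {fset int}) (t : R) : R[i] :=
  avg (B : seq int) (fun b => expi (- (2 * pi * t * b%:~R))).

Lemma symbolD_int B t (k : int) : symbol B (t + k%:~R) = symbol B t.
Proof.
apply: eq_avg => b _.
rewrite -[RHS](expiD_2pi_int _ (- (k * b))) rmorphN rmorphM/=; congr expi; ring.
Qed.

(* Up to a unimodular factor the symbol is a nonzero polynomial in [expi (- 2 pi t)], so
   its zeros are isolated. *)
Lemma symbol_neq0 (B : {fset int}) (t d : R) : (0 < #|` B|)%N -> 0 < d ->
  exists2 t', `|t' - t| < d & symbol B t' != 0.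
Proof.
move=> B0 d0; apply: contrapT => H.
have {}H t' : `|t' - t| < d -> symbol B t' = 0.
  by move=> td; have [//|h] := eqVneq (symbol B t') 0; case: H; exists t'.
(* [K] dominates every |b|, so that multiplying by the K-th power of expi (- 2 pi t) leaves only
   nonnegative exponents. *)
pose K : nat := \sum_(b <- (B : seq int)) `|b|%N.
have bK b : b \in B -> 0 <= b + K%:Z.
  move=> bB; have : (`|b| <= K)%N.
    by rewrite /K (big_rem b)//= leq_addr.
  lia.
pose p : {poly R[i]} := \sum_(b <- (B : seq int)) 'X^(absz (b + K%:Z)).
have p0 : p != 0.
  apply/eqP => /(congr1 (fun q => q.[1])); rewrite /p horner_sum horner0.
  under eq_bigr do rewrite hornerXn expr1n.
  by rewrite big_const_seq count_predT iter_addr addr0 => /eqP; rewrite pnatr_eq0 gtn_eqF.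
pose n := size p.
have [n0 np] : (0 < n)%N /\ n%:R != 0 :> R by rewrite pnatr_eq0 -lt0n lt0n size_poly_eq0.
have n0R : 0 < n%:R :> R by rewrite ltr0n.
(* The samples [tt j], as many as the size of [p], are one more than [p] can have roots. With s <= 1
   / 2 they spread over less than a full turn, so the points [z j] are distinct. *)
pose s := Num.min d (1 / 2).
have s0 : 0 < s by rewrite /s lt_min d0 divr_gt0.
have sd : s <= d by rewrite /s ge_min lexx.
have s1 : s <= 1 / 2 by rewrite /s ge_min lexx orbT.
pose tt (j : nat) := t + s * j%:R / n%:R.
pose z j := expi (- (2 * pi * tt j)).
have zu : uniq [seq z j | j <- iota 0 n].
  rewrite map_inj_in_uniq ?iota_uniq// => i j; rewrite !mem_iota !add0n /= => ni nj.
  wlog ij : i j ni nj / (i < j)%N.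
    move=> W zij; case: (ltngtP i j) => // h; first exact: W.
    by apply/esym/W.
  move=> zij; suff : z i != z j by rewrite zij eqxx.
  have -> : z i = z j * expi (2 * pi * (s * (j - i)%:R / n%:R)).
    rewrite /z -expiD /tt natrB ?(ltnW ij)//; congr expi.
    by field.
  rewrite -[X in _ != X]mulr1 -subr_eq0 -mulrBr mulf_neq0//.
    by apply/eqP => /(congr1 (@ComplexField.Normc.normc R)); rewrite normc_expi ComplexField.Normc.normc0; apply/eqP; rewrite oner_eq0.
  rewrite subr_eq0; apply: expi_neq1; have pp := pi_gt0 R.
  apply/andP; split.
    by rewrite !mulr_gt0 ?invr_gt0// ltr0n subn_gt0.
  rewrite gtr_pMr ?mulr_gt0// ltr_pdivrMr// mul1r.
  apply: (@le_lt_trans _ _ (s * n%:R)).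
    by rewrite ler_pM2l// ler_nat; lia.
  rewrite gtr_pMl//; lra.
have zr : all (root p) [seq z j | j <- iota 0 n].
  apply/allP => w /mapP[j]; rewrite mem_iota add0n => /andP[_ jn] ->.
  have tj : `|tt j - t| < d.
    rewrite /tt addrC addKr ger0_norm; last by rewrite divr_ge0// mulr_ge0// ltW.
    apply: lt_le_trans sd; rewrite ltr_pdivrMr// ltr_pM2l// ltr_nat.
    exact: jn.
  rewrite /root /p horner_sum; apply/eqP.
  have : expi (- (2 * pi * tt j * K%:R)) * (symbol B (tt j) * (#|` B|%:R)) = 0.
    by rewrite H// mul0r mulr0.
  rewrite /symbol /avg mulfVK ?pnatr_eq0 ?gtn_eqF// => h.
  rewrite -[RHS]h mulr_sumr; apply: eq_big_seq => b bB.
  rewrite hornerXn /z -expiMn -expiD; congr expi.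
  have E : ((absz (b + K%:Z))%:R : R) = b%:~R + K%:R.
    by rewrite -[LHS]/((absz (b + K%:Z))%:Z%:~R) gez0_abs ?bK// intrD.
  rewrite -[LHS]mulr_natr E; ring.
have := max_poly_roots p0 zr zu; rewrite size_map size_iota.
by rewrite ltnn.
Qed.

End symbols.

(** * Factorization of the transforms and existence of the tails *)

Section tails.
Context {R : realType}.
Variables (N : nat -> int) (B : nat -> {fset int}).
Hypothesis N0 : forall k, (0 < k)%N -> N k != 0.
Hypothesis B0 : forall k, (0 < k)%N -> (0 < #|` B k|)%N.

Local Notation atoms := (@atoms R N B).

Definition scale (n k : nat) : R := (\prod_(n.+1 <= i < k.+1) N i)%:~R.

Lemma scale_neq0 n k : scale n k != 0.
Proof.
rewrite intr_eq0 prodf_seq_neq0; apply/allP => i; rewrite mem_index_iota => /andP[ni _].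
by apply: N0; apply: leq_ltn_trans ni.
Qed.

Lemma scaleS n k : (n < k)%N -> scale n k = (N n.+1)%:~R * scale n.+1 k.
Proof. by move=> nk; rewrite /scale big_ltn ?intrM// ltnS. Qed.

Lemma scalenn n : scale n n = 1.
Proof. by rewrite /scale big_geq. Qed.

(** [scaled_digits] is an image set, which would merge equal points and alter the weights; dividing
    by a nonzero scale is injective, so no weight changes. *)
Lemma avg_scaled_digits (F : numFieldType) n k (f : R -> F) :
  avg (scaled_digits N B n k : seq R) f = avg (B k : seq int) (fun b => f ((scale n k)^-1 * b%:~R)).
Proof.
rewrite -(avg_map (fun b : int => (scale n k)^-1 * b%:~R)).
have perm_avg (s t : seq R) : perm_eq s t -> avg s f = avg t f.
  by move=> st; rewrite /avg (perm_big _ st) (perm_size st).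
apply: perm_avg; apply: uniq_perm.
- exact: fset_uniq.
- rewrite map_inj_uniq ?fset_uniq// => a b /(mulfI _) h; apply: (@intr_inj R).
  by apply: h; rewrite invr_eq0 scale_neq0.
- by move=> x; apply/imfsetP/mapP => -[b bB ->]; exists b.
Qed.

(* [partial_convolution] adds the last factor; this splits off the first one. *)
Lemma avg_atomsS (F : numFieldType) n m (f : R -> F) :
  avg (atoms n m.+1) f = avg (B n.+1 : seq int) (fun b =>
    avg (atoms n.+1 m) (fun y => f ((b%:~R + y) / (N n.+1)%:~R))).
Proof.
elim: m f => [|m IH] f.
  transitivity (avg [:: 0] (fun x => avg (scaled_digits N B n (n + 1) : seq R) (fun a => f (x + a)))).
    by rewrite [LHS]avg_allpairs.
  have avg1 (x : R) (g : R -> F) : avg [:: x] g = g x by rewrite /avg big_seq1 divr1.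
  rewrite avg1 avg_scaled_digits addn1; apply: eq_avg => b _.
  by rewrite avg1 add0r addr0 scaleS// scalenn mulr1 mulrC.
transitivity (avg (atoms n m.+1) (fun x => avg (scaled_digits N B n (n + m.+2) : seq R) (fun a => f (x + a)))).
  by rewrite [LHS]avg_allpairs.
rewrite IH; apply: eq_avg => b _.
rewrite [RHS]avg_allpairs; apply: eq_avg => y _.
rewrite !avg_scaled_digits addSnnS; apply: eq_avg => c _.
rewrite (@scaleS n); last by rewrite -[X in (X < _)%N]addn0 ltn_add2l.
by congr f; field; rewrite intr_eq0 N0// scale_neq0.
Qed.

(* The Fourier transform of [partial_convolution N B n m]. *)
Definition phi n m (xi : R) : R[i] := avg (atoms n m) (fun x => expi (- (2 * pi * xi * x))).

Lemma phi0 n xi : phi n 0 xi = 1.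
Proof. by rewrite /phi /avg /= big_seq1 mulr0 oppr0 expi0 divr1. Qed.

Lemma phi_at0 n m : phi n m 0 = 1.
Proof.
rewrite /phi -[RHS](@avg_cst _ _ (atoms n m) 1); last exact: size_atoms.
by apply: eq_avg => x _; rewrite mulr0 mul0r oppr0 expi0.
Qed.

Lemma phiS n m xi :
  phi n m.+1 xi = symbol (B n.+1) (xi / (N n.+1)%:~R) * phi n.+1 m (xi / (N n.+1)%:~R).
Proof.
rewrite {1}/phi avg_atomsS [RHS]mulrC /symbol -avgZ; apply: eq_avg => b _.
rewrite [RHS]mulrC /phi -avgZ; apply: eq_avg => y _; rewrite -expiD; congr expi.
by ring.
Qed.

Lemma phiD n m k xi : phi n (m + k) xi = phi n m xi * phi (n + m) k (xi / scale n (n + m)).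
Proof.
elim: m n xi => [|m IH] n xi; first by rewrite add0n addn0 scalenn divr1 phi0 mul1r.
rewrite addSn !phiS IH mulrA addSnnS; congr (_ * phi _ _ _).
rewrite (@scaleS n); last by rewrite -[X in (X < _)%N]addn0 ltn_add2l.
by rewrite invfM mulrA.
Qed.

(** Dividing by [N n.+1] turns the period into an integer, invisible to the symbol of the integer
    digits, and into the period of the remaining block. *)
Lemma phi_periodic n m xi (k : int) : phi n m (xi + scale n (n + m) * k%:~R) = phi n m xi.
Proof.
elim: m n xi => [|m IH] n xi; first by rewrite !phi0.
have nz : (N n.+1)%:~R != 0 :> R by rewrite intr_eq0 N0.
rewrite !phiS (@scaleS n); last by rewrite -[X in (X < _)%N]addn0 ltn_add2l.
have -> : (xi + (N n.+1)%:~R * scale n.+1 (n + m.+1) * k%:~R) / (N n.+1)%:~R =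
  xi / (N n.+1)%:~R + scale n.+1 (n.+1 + m) * k%:~R by rewrite addSnnS; field.
by rewrite IH -rmorphM symbolD_int.
Qed.

Lemma normc_avg (T : eqType) (s : seq T) (f : T -> R[i]) :
  normc (avg s f) <= avg s (fun x => normc (f x)).
Proof.
rewrite /avg ComplexField.Normc.normcM ComplexField.Normc.normcV.
have -> : normc ((size s)%:R : R[i]) = (size s)%:R.
  by rewrite -(rmorph_nat (real_complex R)) normcR normr_nat.
by rewrite ler_wpM2r ?invr_ge0// normc_sum.
Qed.

Lemma normc_phi_le1 n m xi : normc (phi n m xi) <= 1.
Proof.
apply: (le_trans (normc_avg _ _)).
rewrite -[leRHS](@avg_cst _ _ (atoms n m) 1); last exact: size_atoms.
by apply: ler_avg => x _; rewrite normc_expi.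
Qed.

Lemma Re_avg (T : Type) (s : seq T) (f : T -> R[i]) :
  complex.Re (avg s f) = avg s (fun x => complex.Re (f x)).
Proof.
rewrite /avg -(rmorph_nat (real_complex R)) -fmorphV -Re_sum.
by case: (\sum_(x <- s) f x) => a b /=; rewrite mulr0 subr0.
Qed.

Lemma Im_avg (T : Type) (s : seq T) (f : T -> R[i]) :
  complex.Im (avg s f) = avg s (fun x => complex.Im (f x)).
Proof.
rewrite /avg -(rmorph_nat (real_complex R)) -fmorphV -Im_sum.
by case: (\sum_(x <- s) f x) => a b /=; rewrite mulr0 add0r.
Qed.

Lemma BC_cos w : BC (fun x : R => cos (w * x)).
Proof.
split; last by exists 1 => x; exact: cos_max.
move=> x; apply: (@continuous_comp _ _ _ (fun x => w * x) cos); last exact: continuous_cos.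
by apply: cvgM; [exact: cvg_cst|exact: cvg_id].
Qed.

Lemma BC_sin w : BC (fun x : R => sin (w * x)).
Proof.
split; last by exists 1 => x; exact: sin_max.
move=> x; apply: (@continuous_comp _ _ _ (fun x => w * x) sin); last exact: continuous_sin.
by apply: cvgM; [exact: cvg_cst|exact: cvg_id].
Qed.

Lemma integral_partial_BC n m f : BC f ->
  \int[partial_convolution N B n m]_x f x = avg (atoms n m) f.
Proof.
by move=> [cf _]; rewrite integral_partial_convolution//; exact: continuous_measurable_fun.
Qed.

Lemma weakly_cvg_avg n (nu : borel_prob R) : weakly_cvg (partial_convolution N B n) nu <->
  forall f, BC f -> avg (atoms n m) f @[m --> \oo] --> \int[nu]_x f x.
Proof.
split=> [H f bf|H f cf [M [_ fM]]].
  under eq_fun do rewrite -integral_partial_BC//.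
  apply: H; first exact: bf.1.
  have [_ [C fC]] := bf.
  by exists C; split; [exact: num_real|move=> z Cz x _; apply: le_trans (fC x) _; exact: ltW].
have bf : BC f.
  by split => //; exists (M + 1) => x; apply: fM => //; rewrite ltrDl.
by under eq_fun do rewrite integral_partial_BC//; exact: H.
Qed.

Lemma Re_expiN (w x : R) : complex.Re (expi (- (w * x))) = cos (w * x).
Proof. by rewrite /= cosN. Qed.

Lemma Im_expiN (w x : R) : complex.Im (expi (- (w * x))) = - sin (w * x).
Proof. by rewrite /= sinN. Qed.

Lemma Re_phi n m xi : complex.Re (phi n m xi) = avg (atoms n m) (fun x => cos (2 * pi * xi * x)).
Proof. by rewrite /phi Re_avg; apply: eq_avg => x _; rewrite Re_expiN. Qed.

Lemma Im_phi n m xi : complex.Im (phi n m xi) = - avg (atoms n m) (fun x => sin (2 * pi * xi * x)).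
Proof. by rewrite /phi Im_avg -avgN; apply: eq_avg => x _; rewrite Im_expiN. Qed.

Lemma Re_fourier (nu : borel_prob R) xi :
  complex.Re (fourier nu xi) = \int[nu]_x cos (2 * pi * xi * x).
Proof. by rewrite /fourier /cintegral/=; congr Rintegral; apply/funext => x; rewrite cosN. Qed.

Lemma Im_fourier (nu : borel_prob R) xi :
  complex.Im (fourier nu xi) = - \int[nu]_x sin (2 * pi * xi * x).
Proof.
rewrite /fourier /cintegral/=.
under [LHS]eq_Rintegral do rewrite sinN -mulN1r.
by rewrite (posfunZ (posfun_integral nu) (-1) (BC_sin _)) mulN1r.
Qed.

Lemma cvg_phi n nu xi : weakly_cvg (partial_convolution N B n) nu ->
  (complex.Re (phi n m xi) @[m --> \oo] --> complex.Re (fourier nu xi)) /\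
  (complex.Im (phi n m xi) @[m --> \oo] --> complex.Im (fourier nu xi)).
Proof.
move=> /weakly_cvg_avg H; rewrite Re_fourier Im_fourier; split.
  by under eq_fun do rewrite Re_phi; apply: H; exact: BC_cos.
by under eq_fun do rewrite Im_phi; apply: cvgN; apply: H; exact: BC_sin.
Qed.

Lemma tight_integral (nu : borel_prob R) e : 0 < e -> exists2 M, 0 <= M & \int[nu]_x cut M x <= e.
Proof.
move=> e0.
have cvg0 : (\int[nu]_x (cut n%:R x)%:E)%E @[n --> \oo] --> (\int[nu]_x (cst 0%E x))%E.
  have := @dominated_convergence _ (measurableTypeR R) R nu setT measurableT
     (fun n x => (cut n%:R x)%:E) (cst 0%E) (cst 1%E).
  case.
  - by move=> n; apply/measurable_EFinP; apply: continuous_measurable_fun; exact: (BC_cut _).1.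
  - exact: measurable_cst.
  - apply: aeW => x _; apply: cvg_near_cst; near=> n; congr EFin; apply: cut0.
    by near: n; exact: nbhs_infty_ger.
  - by have /= := integrable_BC nu (BC_cst 1).
  - by apply: aeW => x n _; rewrite /= lee_fin ger0_norm ?cut_ge0 ?cut_le1.
  - by move=> _ _; exact.
rewrite integral0 in cvg0.
have /fine_cvg/cvgrPdist_le/(_ e e0) [n _ /(_ n (leqnn n))] := cvg0.
rewrite sub0r normrN => h; exists n%:R => //.
by apply: le_trans h; exact: ler_norm.
Unshelve. all: end_near. Qed.

Lemma expi_uniform (W e : R) : 0 < e -> exists2 d, 0 < d & forall w w' x M,
  0 < M -> `|x| <= M -> `|w - w'| < d / M -> `|w * x| <= W ->
  `|cos (w * x) - cos (w' * x)| < e /\ `|sin (w * x) - sin (w' * x)| < e.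
Proof.
move=> e0.
have [d1 d10 h1] := uniform_continuity_segment W (@continuous_cos R) e0.
have [d2 d20 h2] := uniform_continuity_segment W (@continuous_sin R) e0.
exists (Num.min d1 d2); first by rewrite lt_min d10.
move=> w w' x M M0 xM ww wW.
have : `|w * x - w' * x| < Num.min d1 d2.
  rewrite -mulrBl normrM; apply: (@le_lt_trans _ _ (`|w - w'| * M)).
    by rewrite ler_wpM2l.
  by rewrite -ltr_pdivlMr.
by rewrite lt_min => /andP[u1 u2]; split; [exact: h1|exact: h2].
Qed.

(* One translate of the rescaled tail carries 1/#B of the mass of the previous measure. *)
Lemma tight_tail n (mu : borel_prob R) : weakly_cvg (partial_convolution N B n) mu ->
  forall e, 0 < e ->
  exists2 M, 0 <= M & \forall m \near \oo, avg (atoms n.+1 m) (cut M) <= e.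
Proof.
move=> /weakly_cvg_avg hmu e e0.
have b0 : (0 < #|` B n.+1|)%N by exact: B0.
have b0R : 0 < #|` B n.+1|%:R :> R by rewrite ltr0n.
have E0 : 0 < e / #|` B n.+1|%:R by rewrite divr_gt0.
have E20 : 0 < e / #|` B n.+1|%:R / 2 by rewrite divr_gt0.
have [M M0 hM] := tight_integral mu E20.
have [b bB] : exists b, b \in B n.+1 by apply/fset0Pn; rewrite -cardfs_gt0.
pose q : R := `|(N n.+1)%:~R|.
have q0 : 0 < q by rewrite normr_gt0 intr_eq0 N0.
(* For |y| > M' the point (b + y) / N has modulus at least M + 1, where [cut M] is already 1. *)
pose M' := q * (M + 1) + `|b%:~R|.
exists M'; first by rewrite addr_ge0// mulr_ge0 ?ltW//; lra.
have cutM y : cut M' y <= cut M ((b%:~R + y) / (N n.+1)%:~R).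
  have [yM|yM] := leP `|y| M'; first by rewrite (cut0 yM) cut_ge0.
  rewrite [leRHS]cut1 ?cut_le1// normrM normfV -/q ler_pdivlMr// mulrC.
  have := ler_normB (b%:~R + y) b%:~R; rewrite addrC addKr.
  by move: yM; rewrite /M'; lra.
have := hmu _ (BC_cut M); rewrite -cvg_shiftS => /cvgrPdist_le/(_ _ E20) H.
near=> m.
have : `|\int[mu]_x cut M x - avg (atoms n m.+1) (cut M)| <= e / #|` B n.+1|%:R / 2.
  by near: m.
rewrite ler_norml => /andP[h _].
have {}h : avg (atoms n m.+1) (cut M) <= e / #|` B n.+1|%:R by lra.
rewrite -[leRHS](mulfVK (lt0r_neq0 b0R)) -ler_pdivrMr//.
apply: le_trans h; rewrite avg_atomsS [leRHS]/avg ler_wpM2r ?invr_ge0//.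
have nn c : 0 <= avg (atoms n.+1 m) (fun y => cut M ((c%:~R + y) / (N n.+1)%:~R)).
  rewrite -(@avg_cst _ _ (atoms n.+1 m) 0); last exact: size_atoms.
  by apply: ler_avg => y _; exact: cut_ge0.
rewrite (big_rem b)//= ler_wpDr//; first by apply: sumr_ge0.
by apply: ler_avg => y _.
Unshelve. all: end_near. Qed.

(* By [phiS] the transforms of the tail converge wherever the symbol does not vanish;
   near a zero of the symbol, tightness makes them equicontinuous. *)
Lemma tail_step n (mu : borel_prob R) : weakly_cvg (partial_convolution N B n) mu ->
  exists nu : borel_prob R, weakly_cvg (partial_convolution N B n.+1) nu.
Proof.
move=> hmu; have tight := tight_tail hmu.
suff [hc hs] : (forall w, cvgn (fun m => avg (atoms n.+1 m) (fun x => cos (w * x)))) /\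
    (forall w, cvgn (fun m => avg (atoms n.+1 m) (fun x => sin (w * x)))).
  have [nu hnu] := levy_continuity (size_atoms N B0 n.+1) tight hc hs.
  by exists nu; apply/weakly_cvg_avg.
have pp : 0 < 2 * pi :> R by rewrite mulr_gt0// pi_gt0.
have good t : symbol (B n.+1) t != 0 ->
    cvgn (fun m => avg (atoms n.+1 m) (fun x => cos (2 * pi * t * x))) /\
    cvgn (fun m => avg (atoms n.+1 m) (fun x => sin (2 * pi * t * x))).
  move=> st.
  have E m : phi n.+1 m t = (symbol (B n.+1) t)^-1 * phi n m.+1 (t * (N n.+1)%:~R).
    by rewrite phiS mulfK ?mulKf// intr_eq0 N0.
  have [cR cI] := cvg_phi (t * (N n.+1)%:~R) hmu.
  have {}cR : cvgn (fun m => complex.Re (phi n m.+1 (t * (N n.+1)%:~R))).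
    by move: cR; rewrite -cvg_shiftS => /cvgP.
  have {}cI : cvgn (fun m => complex.Im (phi n m.+1 (t * (N n.+1)%:~R))).
    by move: cI; rewrite -cvg_shiftS => /cvgP.
  have cst (c : R) : cvgn (fun m : nat => c) by exact: is_cvg_cst.
  case: (symbol (B n.+1) t)^-1 E => a b E; split.
    under eq_fun do rewrite -Re_phi E.
    rewrite (_ : (fun m => _) = fun m => a * complex.Re (phi n m.+1 (t * (N n.+1)%:~R))
      - b * complex.Im (phi n m.+1 (t * (N n.+1)%:~R))).
      by apply: is_cvgB; apply: is_cvgM.
    by apply/funext => m; case: (phi _ _ _).
  rewrite (_ : (fun m => _) = fun m => - complex.Im (phi n.+1 m t)); last first.
    by apply/funext => m; rewrite Im_phi opprK.
  apply: is_cvgN; under eq_fun do rewrite E.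
  rewrite (_ : (fun m => _) = fun m => a * complex.Im (phi n m.+1 (t * (N n.+1)%:~R))
      + b * complex.Re (phi n m.+1 (t * (N n.+1)%:~R))).
    by apply: is_cvgD; apply: is_cvgM.
  by apply/funext => m; case: (phi _ _ _).
have approx w e : 0 < e -> exists2 w',
    cvgn (fun m => avg (atoms n.+1 m) (fun x => cos (w' * x))) /\
    cvgn (fun m => avg (atoms n.+1 m) (fun x => sin (w' * x))) &
    \forall m \near \oo,
      `|avg (atoms n.+1 m) (fun x => cos (w * x)) - avg (atoms n.+1 m) (fun x => cos (w' * x))| <= e /\
      `|avg (atoms n.+1 m) (fun x => sin (w * x)) - avg (atoms n.+1 m) (fun x => sin (w' * x))| <= e.
  (* Inside the window the two waves will differ by less than e / 2; outside they differ by at most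
     2, against an average of [cut M] of at most e / 8. *)
  move=> e0; have [M M0 hM] := tight (e / 8) ltac:(by rewrite divr_gt0).
  have M10 : 0 < M + 1 by lra.
  have [d d0 hd] := expi_uniform (`|w| * (M + 1)) (divr_gt0 e0 (ltr0n _ 2)).
  have d10 : 0 < d / (M + 1) / (2 * pi) by rewrite !divr_gt0.
  have [t tw st] := symbol_neq0 (w / (2 * pi)) (B0 (ltn0Sn n)) d10.
  exists (2 * pi * t); first exact: good.
  have ww : `|w - 2 * pi * t| < d / (M + 1).
    have -> : w - 2 * pi * t = - ((t - w / (2 * pi)) * (2 * pi)).
      by rewrite mulrBl opprB mulfVK ?(lt0r_neq0 pp)// [t * _]mulrC.
    by rewrite normrN normrM (gtr0_norm pp) -ltr_pdivlMr.
  near=> m.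
  have cm : avg (atoms n.+1 m) (cut M) <= e / 8 by near: m.
  have H (f g : R -> R) : (forall x, `|f x| <= 1) -> (forall x, `|g x| <= 1) ->
      (forall x, `|x| <= M + 1 -> `|f x - g x| < e / 2) ->
      `|avg (atoms n.+1 m) f - avg (atoms n.+1 m) g| <= e.
    move=> f1 g1 fg; rewrite avgB; apply: (le_trans (ler_norm_avg _ _)).
    apply: (@le_trans _ _ (avg (atoms n.+1 m) (fun x => e / 2 + 2 * cut M x))).
      apply: ler_avg => x _; have [xM|xM] := leP `|x| (M + 1).
        by have := fg x xM; have := cut_ge0 M x; lra.
      rewrite (cut1 (ltW xM)); have := ler_normB (f x) (g x); have := f1 x; have := g1 x; lra.
    rewrite avgD avg_cst; last exact: size_atoms.
    by rewrite avgZ; lra.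
  have W x : `|x| <= M + 1 -> `|w * x| <= `|w| * (M + 1) by move=> ?; rewrite normrM ler_wpM2l.
  split; apply: H => x.
  - exact: cos_max.
  - exact: cos_max.
  - by move=> xM; have [] := hd _ _ _ _ M10 xM ww (W _ xM).
  - exact: sin_max.
  - exact: sin_max.
  - by move=> xM; have [] := hd _ _ _ _ M10 xM ww (W _ xM).
split=> w; apply: approx_cvgn => e e0; have [w' [c1 c2] H] := approx w e e0.
  by exists (fun m => avg (atoms n.+1 m) (fun x => cos (w' * x))) => //; apply: filterS H => m [].
by exists (fun m => avg (atoms n.+1 m) (fun x => sin (w' * x))) => //; apply: filterS H => m [].
Unshelve. all: end_near. Qed.

Lemma tail_exists (mu : borel_prob R) : weakly_cvg (partial_convolution N B 0) mu ->
  forall n, exists nu : borel_prob R, weakly_cvg (partial_convolution N B n) nu.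
Proof.
move=> hmu; elim=> [|n [nu hnu]]; first by exists mu.
exact: tail_step hnu.
Qed.

End tails.

(** * Hadamard triples and the construction of the spectrum *)

Section hadamard.
Context {R : realType}.

(** The (b, b') entry of M M^* = 1, cleared of its factor 1 / #B. *)
Lemma hadamard_row_orthogonality (N : int) (B L : {fset int}) (b b' : int) :
  hadamard_triple R N B L -> b \in B -> b' \in B ->
  \sum_(l <- (L : seq int)) expi (- (2 * pi * (b - b')%:~R * l%:~R / N%:~R) : R) =
  if b == b' then (#|` B|)%:R else 0.
Proof.
move=> [_ BL B2 /unitarymxP U] bB bB'.
have ib : (index b (B : seq int) < #|` B|)%N by rewrite index_mem.
have ib' : (index b' (B : seq int) < #|` B|)%N by rewrite index_mem.
have nB : (#|` B|%:R : R[i]) != 0 by rewrite pnatr_eq0; lia.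
have := congr1 (fun A => fun_of_matrix A (Ordinal ib) (Ordinal ib')) U.
rewrite !mxE -val_eqE /= => H.
have iE : (index b (B : seq int) == index b' (B : seq int)) = (b == b').
  by apply/eqP/eqP => [/(congr1 (nth 0 (B : seq int)))|->//]; rewrite !nth_index.
rewrite iE in H.
transitivity ((#|` B|%:R : R[i]) * (b == b')%:R); last by case: eqP; rewrite ?mulr1 ?mulr0.
rewrite -H (big_nth 0) big_mkord mulr_sumr; apply: eq_bigr => j _.
rewrite !mxE /= !nth_index//.
have cE (c t : R) : (c%:C%C * expi t)^* = c%:C%C * expi (- t).
  rewrite -[LHS]/((c%:C%C * expi t)^*%C) /expi cosN sinN; apply/eqP.
  by rewrite eq_complex /=; apply/andP; split; apply/eqP; ring.
rewrite cE mulrACA -expiD -rmorphM -invfM -expr2 sqr_sqrtr ?ler0n//.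
have h : (#|` B|%:R : R[i]) * ((#|` B|%:R^-1 : R)%:C%C) = 1 by rewrite fmorphV rmorph_nat mulfV.
rewrite [RHS]mulrA [X in _ = X * _]h mul1r.
by congr expi; rewrite intrB; ring.
Qed.

(** Once the square is expanded, summing over [L] kills the pairs b != b', and each of the #B
    diagonal pairs contributes #B against the factor 1 / #B^2. *)
Lemma sum_sqr_symbol (N : int) (B L : {fset int}) xi : hadamard_triple R N B L ->
  \sum_(l <- (L : seq int)) normc (symbol B ((xi + l%:~R) / N%:~R)) ^+ 2 = 1 :> R.
Proof.
move=> H; have [_ _ B2 _] := H.
have nB : (#|` B|%:R : R[i]) != 0 by rewrite pnatr_eq0; lia.
apply: (@complexI R); rewrite raddf_sum /=.
have E (l : int) : (normc (symbol B ((xi + l%:~R) / N%:~R)) ^+ 2)%:C%C =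
    (#|` B|%:R)^-1 ^+ 2 * \sum_(b <- (B : seq int)) \sum_(b' <- (B : seq int))
      expi (- (2 * pi * xi * (b - b')%:~R / N%:~R)) *
      expi (- (2 * pi * (b - b')%:~R * l%:~R / N%:~R)).
  rewrite -mulr_conjc /symbol /avg rmorphM /= fmorphV rmorph_nat mulrACA -expr2 mulrC.
  congr (_ * _); rewrite [X in _ * X]raddf_sum mulr_suml; apply: eq_bigr => b _.
  rewrite mulr_sumr; apply: eq_bigr => b' _.
  by rewrite [X in _ * X]expi_conj -!expiD; congr expi; rewrite intrB; ring.
under eq_bigr do rewrite E.
rewrite -mulr_sumr exchange_big/=.
transitivity ((#|` B|%:R)^-1 ^+ 2 * \sum_(b <- (B : seq int)) (#|` B|%:R : R[i])).
  congr (_ * _); apply: eq_big_seq => b bB.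
  rewrite exchange_big/=.
  transitivity (\sum_(b' <- (B : seq int)) expi (- (2 * pi * xi * (b - b')%:~R / N%:~R)) *
      if b == b' then (#|` B|%:R : R[i]) else 0).
    apply: eq_big_seq => b' bB'.
    by rewrite -mulr_sumr (hadamard_row_orthogonality H).
  rewrite (big_rem b)//= eqxx subrr mulr0 mul0r oppr0 expi0 mul1r.
  rewrite big1_seq ?addr0// => b' /andP[_]; rewrite mem_rem_uniq ?fset_uniq// inE => /andP[bb _].
  by rewrite eq_sym (negbTE bb) mulr0.
rewrite big_const_seq count_predT iter_addr addr0 -[X in _ * X = _]mulr_natr expr2.
by rewrite mulrACA mulVf ?mul1r.
Qed.

(** The identity holds for every [xi], which absorbs a translation of the frequencies. The leading 0
    is what later lets a spectrum contain the preceding one. *)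
Lemma sum_sqr_symbol_zero_based (N : int) (B L : {fset int}) : hadamard_triple R N B L ->
  exists D : seq int, forall xi : R,
  \sum_(l <- 0 :: D) normc (symbol B ((xi + l%:~R) / N%:~R)) ^+ 2 = 1.
Proof.
move=> H; have := @sum_sqr_symbol N B L ^~ H.
have : (0 < size (L : seq int))%N by have [_ BL B2 _] := H; rewrite -BL; lia.
case: (L : seq int) => // l0 s _ HL.
exists [seq l - l0 | l <- s] => xi.
have -> : 0 :: [seq l - l0 | l <- s] = [seq l - l0 | l <- l0 :: s] by rewrite /= subrr.
rewrite big_map.
rewrite -[RHS](HL (xi - l0%:~R)); apply: eq_bigr => l _.
by rewrite intrB; congr (normc (symbol _ (_ / _)) ^+ 2); ring.
Qed.

End hadamard.

(** * Nested spectra and the Parseval identity *)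

Section spectra.
Context {R : realType}.
Variables (N : nat -> int) (B L : nat -> {fset int}).
Hypothesis hHad : forall n, (1 <= n)%N -> hadamard_triple R (N n) (B n) (L n).

Let N2 k : (0 < k)%N -> 2 <= `|N k|.
Proof. by move=> /hHad[]. Qed.

Let N0 k : (0 < k)%N -> N k != 0.
Proof. by move=> /N2; apply: contraTneq => ->; rewrite normr0. Qed.

Let B0 k : (0 < k)%N -> (0 < #|` B k|)%N.
Proof. by move=> /hHad[_ _ B2 _]; lia. Qed.

Local Notation phi := (@phi R N B).
Local Notation scale := (@scale R N).
Local Notation q := (@partial_convolution R N B).

(** Mixed-radix frequencies l1 + N l2: the multiple of N moves the argument of the first symbol by
    an integer, so the sum over l2 is 1 by induction and the sum over l1 is the Hadamard
    identity. *)
Lemma block_spectrum n m : exists D : seq int, forall xi : R,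
  \sum_(l <- 0 :: D) normc (phi n m (xi + l%:~R)) ^+ 2 = 1.
Proof.
elim: m n => [|m IH] n.
  exists [::] => xi; rewrite big_seq1 phi0.
  by rewrite ComplexField.Normc.normc1 expr1n.
have nz : (N n.+1)%:~R != 0 :> R by rewrite intr_eq0 N0.
have [D1 h1] := sum_sqr_symbol_zero_based (hHad (ltn0Sn n)).
have [D2 h2] := IH n.+1.
pose s := [seq l1 + N n.+1 * l2 | l2 <- 0 :: D2, l1 <- 0 :: D1].
exists (behead s) => xi.
have -> : 0 :: behead s = s by rewrite /s /= mulr0 addr0.
rewrite /s big_allpairs_dep/= exchange_big/= -[RHS](h1 xi).
apply: eq_bigr => l1 _.
rewrite -[RHS]mulr1 -[X in _ = _ * X](h2 ((xi + l1%:~R) / (N n.+1)%:~R)) mulr_sumr.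
apply: eq_bigr => l2 _; rewrite phiS//.
have -> : (xi + (l1 + N n.+1 * l2)%:~R) / (N n.+1)%:~R = (xi + l1%:~R) / (N n.+1)%:~R + l2%:~R.
  by rewrite intrD intrM; field.
by rewrite symbolD_int ComplexField.Normc.normcM exprMn.
Qed.

Lemma scale_ge n m : m%:R <= `|scale n (n + m)|.
Proof.
suff H : 2 ^+ m <= `|scale n (n + m)|.
  apply: le_trans H; rewrite -natrX ler_nat.
  by apply: ltnW; exact: ltn_expl.
elim: m n => [|m IH] n; first by rewrite addn0 scalenn normr1 expr0.
rewrite scaleS; last by rewrite -[X in (X < _)%N]addn0 ltn_add2l.
rewrite normrM exprS ler_pM// ?exprn_ge0//; last by rewrite -addSnnS.
by have := N2 (ltn0Sn n); rewrite -(ler_int R) intr_norm.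
Qed.

Variables (mu : borel_prob R) (hmu : weakly_cvg (q 0) mu).

Lemma cvg_normc_phi n nu xi : weakly_cvg (q n) nu ->
  normc (phi n m xi) ^+ 2 @[m --> \oo] --> normc (fourier nu xi) ^+ 2.
Proof.
move=> hnu; have [cR cI] := cvg_phi B0 xi hnu.
rewrite sqr_normcE; under eq_fun do rewrite sqr_normcE.
by apply: cvgD; rewrite !expr2; under eq_fun do rewrite expr2; exact: cvgM.
Qed.

(** The limit of [phiD]; squared moduli reduce it to a limit of real sequences, and moduli are all
    that the estimates need. *)
Lemma fourier_factor n nu xi : weakly_cvg (q n) nu ->
  normc (fourier mu xi) = normc (phi 0 n xi) * normc (fourier nu (xi / scale 0 n)).
Proof.
move=> hnu; apply/eqP; rewrite -(@eqrXn2 _ 2) ?mulr_ge0 ?normc_ge0// exprMn; apply/eqP.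
have c1 := @cvg_normc_phi n nu (xi / scale 0 n) hnu.
have c2 := @cvg_normc_phi 0 mu xi hmu.
have {}c2 : normc (phi 0 (m + n) xi) ^+ 2 @[m --> \oo] --> normc (fourier mu xi) ^+ 2.
  by rewrite (cvg_shiftn n (fun m => normc (phi 0 m xi) ^+ 2)).
have {}c1 : normc (phi 0 n xi) ^+ 2 * normc (phi n m (xi / scale 0 n)) ^+ 2 @[m --> \oo] -->
    normc (phi 0 n xi) ^+ 2 * normc (fourier nu (xi / scale 0 n)) ^+ 2.
  by apply: cvgM => //; exact: cvg_cst.
have E m : normc (phi 0 (m + n) xi) ^+ 2 =
    normc (phi 0 n xi) ^+ 2 * normc (phi n m (xi / scale 0 n)) ^+ 2.
  by rewrite addnC phiD// ComplexField.Normc.normcM exprMn add0n.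
rewrite (eq_cvg _ _ E) in c2.
by rewrite -(cvg_lim _ c2)// -(cvg_lim _ c1).
Qed.

Lemma normc_fourier_le1 n nu xi : weakly_cvg (q n) nu -> normc (fourier nu xi) <= 1.
Proof.
move=> hnu; rewrite -(@ler_sqr _ _ 1) ?nnegrE ?normc_ge0// expr1n.
have c := @cvg_normc_phi n nu xi hnu; rewrite -(cvg_lim _ c)//.
apply: limr_le; first exact: (cvgP _ c).
by apply: nearW => m; rewrite expr_le1 ?normc_ge0//; exact: normc_phi_le1.
Qed.

Lemma normc_fourier_le_phi n xi : normc (fourier mu xi) <= normc (phi 0 n xi).
Proof.
have [nu hnu] := tail_exists N0 B0 hmu n.
by rewrite (fourier_factor _ hnu) ler_piMr ?normc_ge0// (normc_fourier_le1 _ hnu).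
Qed.

(* The Jorgensen-Pedersen criterion for the finite measure [partial_convolution N B 0 n]. *)
Definition spectrum_of n (Lam : seq int) := forall xi : R,
  \sum_(l <- Lam) normc (phi 0 n (xi + l%:~R)) ^+ 2 = 1.

Variables (n_ : nat -> nat) (n_incr : forall i j, (i < j)%N -> (n_ i < n_ j)%N).
Variables (eps delta : R) (eps0 : 0 < eps) (delta0 : 0 < delta).
Hypothesis eqpos : forall x : R, 0 <= x < 1 -> forall nu, tail_family N B n_ nu ->
  exists k : int, (x = 0 -> k = 0) /\
    forall y : R, `|y| < delta -> eps <= normc (fourier nu (x + y + k%:~R)).

Let n_ge j : (j <= n_ j)%N.
Proof. by elim: j => // j IH; apply: leq_ltn_trans IH _; exact: n_incr. Qed.

(* With [D] a spectrum of the block n+1, ..., n' and P, P' the products N_1 ... N_n and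
   N_1 ... N_n', the new frequencies are t + P l + P' kappa: the multiple of P' does
   not change [phi 0 n'] and is chosen by equi-positivity so that the tail of [mu]
   stays above [eps]. The old frequencies need no shift because k = 0 for x = 0. *)
Lemma spectrum_step n Lam : spectrum_of n Lam -> exists n' ext,
  [/\ (n < n')%N, spectrum_of n' (Lam ++ ext) &
    forall l, l \in Lam ++ ext -> forall xi : R, `|xi| < delta / 2 * `|scale 0 n'| ->
      eps * normc (phi 0 n' (xi + l%:~R)) <= normc (fourier mu (xi + l%:~R))].
Proof.
move=> sL.
pose A : R := \sum_(l <- Lam) `|l%:~R|.
(* Since |P'| is at least n' >= j, every old l / P' falls below delta / 2, which leaves the other
   half of the window around 0 to xi / P'. *)
pose j := (n + (Num.truncn (A / (delta / 2))).+1)%N.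
have d2 : 0 < delta / 2 by rewrite divr_gt0.
pose n' := n_ j.
have jn' : (j <= n')%N by exact: n_ge.
have nn' : (n < n')%N by apply: leq_trans jn'; rewrite /j addnS ltnS leq_addr.
have big l : l \in Lam -> `|l%:~R / scale 0 n'| < delta / 2.
  move=> lL; have s0 : 0 < `|scale 0 n'| by rewrite normr_gt0 scale_neq0.
  rewrite normrM normfV ltr_pdivrMr// -ltr_pdivrMl// mulrC.
  apply: le_lt_trans (_ : A / (delta / 2) < _).
    rewrite ler_pM2r ?invr_gt0// /A (big_rem l)//= lerDl.
    by apply: sumr_ge0.
  apply: lt_le_trans (truncnS_gt _) _; apply: le_trans (scale_ge 0 n'); rewrite ler_nat.
  by apply: leq_trans jn'; rewrite /j leq_addl.
have [nu hnu] := tail_exists N0 B0 hmu n'.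
have tnu : tail_family N B n_ nu by exists j.
have [D hD] := block_spectrum n (n' - n).
have sn' : (n + (n' - n) = n')%N by rewrite subnKC// ltnW.
pose P : int := \prod_(1 <= i < n.+1) N i.
pose P' : int := \prod_(1 <= i < n'.+1) N i.
have PE : P%:~R = scale 0 n by [].
have P'E : P'%:~R = scale 0 n' by [].
have : forall t : int, exists k : int, forall y : R, `|y| < delta ->
    eps <= normc (fourier nu (t%:~R / scale 0 n' + k%:~R + y)).
  (* Equi-positivity is applied at the fractional part of t / P', and the floor is absorbed in the
     integer shift. *)
  move=> t; pose r : R := t%:~R / scale 0 n'.
  have [|k [_ hk]] := eqpos (x := r - (Num.floor r)%:~R) _ tnu.
    by rewrite subr_ge0 Num.Theory.floor_le_tmp ltrBlDr addrC -intrD1 Num.Theory.floorD1_gt.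
  exists (k - Num.floor r) => y /hk; rewrite intrB -/r.
  by congr (_ <= normc (fourier _ _)); ring.
move=> /choice[kappa hkappa].
have small l : l \in Lam -> forall y, `|y| < delta / 2 ->
    eps <= normc (fourier nu (l%:~R / scale 0 n' + y)).
  move=> /big lb y yd; have [|k [k0 hk]] := eqpos (x := 0) _ tnu; first by rewrite lexx ltr01.
  have := hk (l%:~R / scale 0 n' + y); rewrite add0r k0// addr0; apply.
  by apply: (le_lt_trans (ler_normD _ _)); rewrite [ltRHS]splitr ltrD.
pose g (l t : int) : int := t + P * l + P' * kappa (t + P * l).
exists n', [seq g l t | l <- D, t <- Lam]; split=> //.
- move=> xi; rewrite big_cat big_allpairs_dep/=.
  have per (x : R) (k : int) : phi 0 n' (x + (P' * k)%:~R) = phi 0 n' x.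
    by rewrite intrM P'E -[in scale 0 n'](add0n n'); exact: phi_periodic.
  have E l t : phi 0 n' (xi + (g l t)%:~R) = phi 0 n' (xi + (t + P * l)%:~R).
    by rewrite /g intrD addrA per.
  transitivity (\sum_(l <- 0 :: D) \sum_(t <- Lam) normc (phi 0 n' (xi + (t + P * l)%:~R)) ^+ 2).
    rewrite big_cons; congr (_ + _).
      by apply: eq_bigr => t _; rewrite mulr0 addr0.
    by apply: eq_bigr => l _; apply: eq_bigr => t _; rewrite E.
  rewrite exchange_big/= -[RHS](sL xi); apply: eq_bigr => t _.
  rewrite -[RHS]mulr1 -[X in _ = _ * X](hD ((xi + t%:~R) / scale 0 n)) mulr_sumr.
  apply: eq_bigr => l _.
  have -> : phi 0 n' (xi + (t + P * l)%:~R) =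
      phi 0 n (xi + t%:~R) * phi n (n' - n) ((xi + t%:~R) / scale 0 n + l%:~R).
    rewrite -{1}sn' phiD// add0n; congr (_ * phi _ _ _).
      rewrite -[RHS](phi_periodic B N0 0 n _ l) add0n; congr phi.
      by rewrite intrD intrM PE addrA.
    by rewrite intrD intrM PE; field; rewrite scale_neq0.
  by rewrite ComplexField.Normc.normcM exprMn.
- move=> l lin xi xid.
  rewrite (fourier_factor _ hnu) [eps * _]mulrC ler_wpM2l ?normc_ge0//.
  have s0 : 0 < `|scale 0 n'| by rewrite normr_gt0 scale_neq0.
  have xd : `|xi / scale 0 n'| < delta / 2 by rewrite normrM normfV ltr_pdivrMr.
  rewrite mulrDl addrC; move: lin; rewrite mem_cat => /orP[lL|]; first exact: small.
  move=> /allpairsP[[l0 t] /= [_ _ ->]].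
  have := hkappa (t + P * l0) (xi / scale 0 n') _; rewrite /g.
  have -> : (t + P * l0 + P' * kappa (t + P * l0))%:~R / scale 0 n' =
     (t + P * l0)%:~R / scale 0 n' + (kappa (t + P * l0))%:~R.
    by rewrite intrD [X in _ + X]intrM P'E mulrDl; congr (_ + _); field; rewrite scale_neq0.
  by apply; apply: lt_trans xd _; rewrite ltr_pdivrMr// ltr_pMr// ltr1n.
Qed.

(** The lower bound is asked only from rank 1 on, because the initial spectrum does not come from
    [spectrum_step]. *)
Definition spectral_tower (nn : nat -> nat) (Lam : nat -> seq int) := forall j,
  [/\ spectrum_of (nn j) (Lam j), (nn j < nn j.+1)%N,
      exists ext, Lam j.+1 = Lam j ++ ext &
      forall l, l \in Lam j.+1 -> forall xi : R, `|xi| < delta / 2 * `|scale 0 (nn j.+1)| ->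
      eps * normc (phi 0 (nn j.+1) (xi + l%:~R)) <= normc (fourier mu (xi + l%:~R))].

Lemma spectral_tower_exists : exists nn Lam, spectral_tower nn Lam.
Proof.
(* The premise stands inside the existential, so that [choice] gives a successor function on
   arbitrary pairs. *)
have H (s : nat * seq int) : exists t : nat * seq int, spectrum_of s.1 s.2 ->
    [/\ spectrum_of t.1 t.2, (s.1 < t.1)%N, exists ext, t.2 = s.2 ++ ext &
      forall l, l \in t.2 -> forall xi : R, `|xi| < delta / 2 * `|scale 0 t.1| ->
      eps * normc (phi 0 t.1 (xi + l%:~R)) <= normc (fourier mu (xi + l%:~R))].
  have [hs|hs] := pselect (spectrum_of s.1 s.2); last by exists s => /hs.
  have [n' [ext [h1 h2 h3]]] := spectrum_step hs.
  by exists (n', s.2 ++ ext) => _; split=> //; exists ext.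
have [f hf] := choice H.
(* The empty convolution is the Dirac mass at 0, with spectrum {0}. *)
pose st j := iter j f (0%N, [:: 0 : int]).
have hst j : spectrum_of (st j).1 (st j).2.
  elim: j => [|j IH]; last by have [] := hf _ IH.
  by move=> xi; rewrite big_seq1 phi0 ComplexField.Normc.normc1 expr1n.
exists (fun j => (st j).1), (fun j => (st j).2) => j.
by have [] := hf _ (hst j).
Qed.

(** At xi = - l' the single term l = l' already equals 1, so all others vanish. A repeated frequency
    would be such a vanishing term equal to 1, and zeros of [phi 0 n] are zeros of the smaller
    transform of [mu]. *)
Lemma spectrum_orthogonal n Lam : spectrum_of n Lam ->
  uniq Lam /\ forall l l', l \in Lam -> l' \in Lam -> l != l' ->
    fourier mu (l%:~R - l'%:~R) = 0.
Proof.
move=> sL.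
have H l l' : l' \in Lam -> l \in rem l' Lam -> phi 0 n (l%:~R - l'%:~R) = 0.
  move=> l'L lr; have := sL (- l'%:~R); rewrite (big_rem l')//=.
  rewrite addNr phi_at0// ComplexField.Normc.normc1 expr1n.
  rewrite (big_rem l)//= addrA => /eqP; rewrite -subr_eq0 -addrA addrAC subrr add0r.
  rewrite paddr_eq0 ?sqr_ge0//; last by apply: sumr_ge0 => i _; exact: sqr_ge0.
  by rewrite sqrf_eq0 addrC => /andP[/eqP/ComplexField.Normc.eq0_normc].
split.
  have {}H l : l \in Lam -> l \notin rem l Lam.
    move=> lL; apply/negP => /(H l l lL); rewrite subrr phi_at0// => /eqP.
    by rewrite oner_eq0.
  elim: Lam {sL} H => //= a s IH H; apply/andP; split.
    by have := H a (mem_head _ _); rewrite eqxx.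
  apply: IH => l ls; have := H l; rewrite inE ls orbT => /(_ isT).
  case: ifP => [/eqP al|_]; last by rewrite inE negb_or => /andP[].
  by rewrite ls.
move=> l l' lL l'L ll'; apply: ComplexField.Normc.eq0_normc; apply/eqP.
rewrite eq_le normc_ge0 andbT; apply: le_trans (normc_fourier_le_phi n _) _.
rewrite H ?ComplexField.Normc.normc0//.
by move: lL; rewrite (perm_mem (perm_to_rem l'L)) inE (negbTE ll').
Qed.

Lemma parseval_tower nn Lam : spectral_tower nn Lam -> forall xi,
  \sum_(l <- Lam j) normc (fourier mu (xi + l%:~R)) ^+ 2 @[j --> \oo] --> (1 : R).
Proof.
move=> H xi; pose S j := \sum_(l <- Lam j) normc (fourier mu (xi + l%:~R)) ^+ 2.
have S1 j : S j <= 1.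
  have [sL _ _ _] := H j; rewrite -(sL xi); apply: ler_sum => l _.
  by rewrite ler_sqr ?nnegrE ?normc_ge0//; exact: normc_fourier_le_phi.
have SS j k : exists ext, Lam (j + k)%N = Lam j ++ ext.
  elim: k => [|k [e he]]; first by exists [::]; rewrite addn0 cats0.
  rewrite addnS; have [_ _ [e' ->] _] := H (j + k)%N.
  by exists (e ++ e'); rewrite he catA.
have Snd : nondecreasing_seq S.
  move=> i j ij; have [e he] := SS i (j - i)%N; rewrite subnKC// in he.
  by rewrite /S he big_cat/= lerDl; apply: sumr_ge0 => l _; exact: sqr_ge0.
have cS : cvgn S.
  by apply: nondecreasing_is_cvgn => //; exists 1 => _ [j _ <-].
suff E : limn S = 1 by have : S @ \oo --> limn S := cS; rewrite E.
apply/le_anti; apply/andP; split; first by apply: limr_le => //; exact: nearW.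
have nn_ge j : (j <= nn j)%N.
  by elim: j => // j IH; apply: leq_ltn_trans IH _; have [] := H j.
have nncvg : nn j @[j --> \oo] --> \oo.
  apply/cvgnyPge => A; near=> j; apply: leq_trans (nn_ge j); near: j.
  exact: nbhs_infty_ge.
have e2 : 0 < eps ^+ 2 by rewrite exprn_gt0.
(* At rank j > i the sum 1 is split along [Lam i]. On this fixed finite list the terms converge to
   those of [S i]; on the added frequencies the lower bound gives at most eps^-2 (S j - S i). *)
have lower i : 1 <= S i + (eps ^+ 2)^-1 * (limn S - S i).
  have c1 : \sum_(l <- Lam i) normc (phi 0 (nn j) (xi + l%:~R)) ^+ 2 @[j --> \oo] --> S i.
    rewrite /S; elim: (Lam i) => [|l s IH].
      by rewrite big_nil; under eq_fun do rewrite big_nil; exact: cvg_cst.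
    rewrite big_cons; under eq_fun do rewrite big_cons.
    apply: cvgD IH.
    exact: (cvg_comp _ _ nncvg (@cvg_normc_phi 0 mu (xi + l%:~R) hmu)).
  have c2 : \sum_(l <- Lam i) normc (phi 0 (nn j) (xi + l%:~R)) ^+ 2 +
      (eps ^+ 2)^-1 * (S j - S i) @[j --> \oo] --> S i + (eps ^+ 2)^-1 * (limn S - S i).
    apply: cvgD => //; apply: cvgMr; apply: cvgB => //; exact: cvg_cst.
  rewrite -(cvg_lim _ c2)//; apply: limr_ge; first exact: (cvgP _ c2).
  near=> j.
  have ij : (i.+1 <= j)%N by near: j; exact: nbhs_infty_ge.
  have jbig : `|xi| / (delta / 2) < j%:R by near: j; exact: nbhs_infty_gtr.
  have [j' jE] : exists j', j = j'.+1 by exists j.-1; rewrite prednK//; exact: leq_trans ij.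
  rewrite jE in ij jbig *; clear jE.
  have [_ _ _ HB] := H j'; have [sL _ _ _] := H j'.+1.
  have xd : `|xi| < delta / 2 * `|scale 0 (nn j'.+1)|.
    rewrite -ltr_pdivrMl ?divr_gt0// mulrC; apply: lt_le_trans jbig _.
    apply: le_trans (scale_ge 0 _); rewrite ler_nat; exact: nn_ge.
  have [e he] := SS i (j'.+1 - i)%N; rewrite subnKC ?(ltnW ij)// in he.
  rewrite -{1}(sL xi) /S he !big_cat/= addrAC subrr add0r lerD2l.
  rewrite mulr_sumr !big_seq; apply: ler_sum => l le.
  rewrite mulrC ler_pdivlMr// mulrC -exprMn ler_sqr ?nnegrE ?normc_ge0 ?mulr_ge0 ?normc_ge0 ?(ltW eps0)//.
  by apply: HB => //; rewrite he mem_cat le orbT.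
have c3 : S i + (eps ^+ 2)^-1 * (limn S - S i) @[i --> \oo] --> limn S + (eps ^+ 2)^-1 * (limn S - limn S).
  apply: cvgD => //; apply: cvgMr; apply: cvgB => //; exact: cvg_cst.
rewrite subrr mulr0 addr0 in c3.
by rewrite -[leRHS](cvg_lim _ c3)//; apply: limr_ge; [exact: (cvgP _ c3)|exact: nearW].
Unshelve. all: end_near. Qed.

End spectra.

(** * Completeness in L2 *)

Section square_norm.
Context {R : realType}.
Variable mu : borel_prob R.
Implicit Types (f g h : R -> R[i]).

Definition cmeas f :=
  measurable_fun setT ((fun x => complex.Re (f x)) : measurableTypeR R -> R) /\
  measurable_fun setT ((fun x => complex.Im (f x)) : measurableTypeR R -> R).

Lemma cmeasD f g : cmeas f -> cmeas g -> cmeas (fun x => f x + g x).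
Proof.
move=> [f1 f2] [g1 g2]; split.
  by under eq_fun do rewrite ReD; exact: measurable_realfun.measurable_funD.
by under eq_fun do rewrite ImD; exact: measurable_realfun.measurable_funD.
Qed.

Lemma cmeasZ c f : cmeas f -> cmeas (fun x => c * f x).
Proof.
move=> [f1 f2]; case: c => a b; split.
  rewrite (_ : (fun x => _) = fun x => a * complex.Re (f x) - b * complex.Im (f x)).
    by apply: measurable_funB; apply: measurable_funM.
  by apply/funext => x; case: (f x).
rewrite (_ : (fun x => _) = fun x => a * complex.Im (f x) + b * complex.Re (f x)).
  by apply: measurable_realfun.measurable_funD; apply: measurable_funM.
by apply/funext => x; case: (f x).
Qed.

Lemma cmeasB f g : cmeas f -> cmeas g -> cmeas (fun x => f x - g x).
Proof.
move=> mf mg; under [X in cmeas X]eq_fun do rewrite -mulN1r.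
by apply: cmeasD => //; exact: cmeasZ.
Qed.

Lemma cmeas_sum (I : Type) (s : seq I) (F : I -> R -> R[i]) :
  (forall i, cmeas (F i)) -> cmeas (fun x => \sum_(i <- s) F i x).
Proof.
move=> mF; elim: s => [|i s IH].
  by split; under eq_fun do rewrite big_nil; exact: measurable_cst.
by under [X in cmeas X]eq_fun do rewrite big_cons; exact: cmeasD.
Qed.

Lemma cmeas_expi w : cmeas (fun x => expi (w * x)).
Proof.
by split; apply: continuous_measurable_fun; [exact: (BC_cos w).1|exact: (BC_sin w).1].
Qed.

Lemma cmeasR (u : R -> R) : measurable_fun setT (u : measurableTypeR R -> R) ->
  cmeas (fun x => (u x)%:C%C).
Proof. by move=> mu_; split => //=; exact: measurable_cst. Qed.

(** Squared norms replace the triangle inequality by |z + w|^2 <= 2 |z|^2 + 2 |w|^2, whose factor is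
    harmless in closure arguments. *)
Definition sqnorm f : \bar R := (\int[mu]_x (normc (f x) ^+ 2)%:E)%E.

Lemma measurable_sqnormc f : cmeas f ->
  measurable_fun setT ((fun x => (normc (f x) ^+ 2)%:E) : measurableTypeR R -> \bar R).
Proof.
move=> [f1 f2]; apply/measurable_EFinP.
under eq_fun do rewrite sqr_normcE.
by apply: measurable_realfun.measurable_funD; exact: measurable_funX.
Qed.

Lemma sqr_normcD (z w : R[i]) : normc (z + w) ^+ 2 <= 2 * normc z ^+ 2 + 2 * normc w ^+ 2.
Proof.
rewrite !sqr_normcE ReD ImD.
have := sqr_ge0 (complex.Re z - complex.Re w); have := sqr_ge0 (complex.Im z - complex.Im w).
nra.
Qed.

Local Open Scope ereal_scope.

Lemma sqnormD f g : cmeas f -> cmeas g ->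
  sqnorm (fun x => f x + g x)%R <= 2%:E * sqnorm f + 2%:E * sqnorm g.
Proof.
move=> mf mg; rewrite /sqnorm.
have n0 h x : 0 <= (normc (h x) ^+ 2)%:E by rewrite lee_fin sqr_ge0.
have mm h : cmeas h -> measurable_fun setT
    ((fun x => 2%:E * (normc (h x) ^+ 2)%:E) : measurableTypeR R -> \bar R).
  by move=> mh; apply: measurable_funeM; exact: measurable_sqnormc.
rewrite -!ge0_integralZl_EFin//; try exact: measurable_sqnormc.
rewrite -ge0_integralD//; try exact: mm; try by move=> x _; rewrite mule_ge0.
apply: ge0_le_integral => //.
- by move=> x _; rewrite lee_fin sqr_ge0.
- by apply: (@measurable_sqnormc (fun x => f x + g x)%R); exact: cmeasD.
- by apply: emeasurable_funD; exact: mm.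
- by move=> x _; rewrite -!EFinM -EFinD lee_fin sqr_normcD.
Qed.

Lemma sqnorm_dominated (u_ : nat -> R -> R[i]) (u : R -> R[i]) (G : R -> R) :
  (forall n, cmeas (u_ n)) -> cmeas u ->
  mu.-integrable setT (EFin \o (G : measurableTypeR R -> R)) ->
  (forall x, (normc (u x - u_ n x) ^+ 2)%R @[n --> \oo] --> (0 : R)%R) ->
  (forall n x, (normc (u x - u_ n x) ^+ 2 <= G x)%R) ->
  forall e : R, (0 < e)%R -> exists n, sqnorm (fun x => u x - u_ n x)%R < e%:E.
Proof.
move=> mu_ mu0 iG cv dom e e0.
have [||||| _ _ H] := @dominated_convergence _ (measurableTypeR R) R mu setT measurableT
  (fun n x => (normc (u x - u_ n x) ^+ 2)%:E) (cst 0) (EFin \o G).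
- by move=> n; apply: (@measurable_sqnormc (fun x => u x - u_ n x)%R); exact: cmeasB.
- exact: measurable_cst.
- by apply: aeW => x _; apply: cvg_EFin; [exact: nearW|exact: cv].
- exact: iG.
- by apply: aeW => x n _; rewrite /= lee_fin ger0_norm ?sqr_ge0.
rewrite integral0 in H.
have : \forall n \near \oo, sqnorm (fun x => u x - u_ n x)%R < e%:E.
  apply: (H [set y | y < e%:E]); apply: open_nbhs_nbhs; split => //=.
    exact: open_ereal_lt_ereal.
by move=> [n _ /(_ n (leqnn n))]; exists n.
Qed.

Local Close Scope ereal_scope.

Lemma sqnormZ c f : cmeas f -> sqnorm (fun x => c * f x) = ((normc c ^+ 2)%:E * sqnorm f)%E.
Proof.
move=> mf; rewrite /sqnorm -ge0_integralZl_EFin//; last 2 first.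
- exact: measurable_sqnormc.
- exact: sqr_ge0.
- by apply: eq_integral => x _; rewrite ComplexField.Normc.normcM exprMn EFinM.
- by move=> x _; rewrite lee_fin sqr_ge0.
Qed.

Lemma sqnorm_lt0 f (e : R) : 0 < e -> (forall x, f x = 0) -> (sqnorm f < e%:E)%E.
Proof.
move=> e0 f0; rewrite /sqnorm integral0_eq ?lte_fin// => x _.
by rewrite f0 ComplexField.Normc.normc0 expr0n.
Qed.

End square_norm.

(** * From all exponentials to all of L2 *)

Section closed_span.
Context {R : realType}.
Variables (mu : borel_prob R) (Lam : set R).
Implicit Types (f g P : R -> R[i]).

(* [in_closure] is membership in the closed linear span of the exponentials with
   frequencies in [Lam]. *)
Definition in_span P := exists t : seq (R[i] * R),
  (forall p, p \in t -> Lam p.2) /\ forall x, P x = \sum_(p <- t) p.1 * expi (2 * pi * p.2 * x).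

Lemma cmeas_span P : in_span P -> cmeas P.
Proof.
move=> [t [_ /funext ->]]; apply: cmeas_sum => p.
by apply: cmeasZ; exact: cmeas_expi.
Qed.

Lemma in_spanD P Q : in_span P -> in_span Q -> in_span (fun x => P x + Q x).
Proof.
move=> [s [hs Ps]] [t [ht Qt]]; exists (s ++ t); split.
  by move=> p; rewrite mem_cat => /orP[/hs|/ht].
by move=> x; rewrite big_cat/= Ps Qt.
Qed.

Lemma in_spanZ c P : in_span P -> in_span (fun x => c * P x).
Proof.
move=> [s [hs Ps]]; exists [seq (c * p.1, p.2) | p <- s]; split.
  by move=> _ /mapP[p /hs hp ->].
by move=> x; rewrite big_map Ps mulr_sumr; apply: eq_bigr => p _; rewrite mulrA.
Qed.

Definition in_closure f := cmeas f /\ forall e : R, 0 < e ->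
  exists2 P, in_span P & (sqnorm mu (fun x => f x - P x)%R < e%:E)%E.

Lemma in_closureD f g : in_closure f -> in_closure g -> in_closure (fun x => f x + g x).
Proof.
move=> [mf hf] [mg hg]; split; first exact: cmeasD.
move=> e e0; have e4 : 0 < e / 4 by rewrite divr_gt0.
have [P sP fP] := hf _ e4; have [Q sQ gQ] := hg _ e4.
exists (fun x => P x + Q x); first exact: in_spanD.
have mfP : cmeas (fun x => f x - P x) by apply: cmeasB => //; exact: cmeas_span.
have mgQ : cmeas (fun x => g x - Q x) by apply: cmeasB => //; exact: cmeas_span.
rewrite (_ : (fun x => _) = fun x => (f x - P x) + (g x - Q x)); last first.
  by apply/funext => x; rewrite opprD addrACA.
apply: (le_lt_trans (sqnormD mu mfP mgQ)).
have -> : e%:E = (2%:E * (e / 4)%:E + 2%:E * (e / 4)%:E)%E.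
  by rewrite -!EFinM -EFinD; congr EFin; lra.
by apply: lteD; rewrite lte_pmul2l// lte_fin.
Qed.

Lemma in_closureZ c f : in_closure f -> in_closure (fun x => c * f x).
Proof.
move=> [mf hf]; split; first exact: cmeasZ.
move=> e e0; have e4 : 0 < e / (normc c ^+ 2 + 1).
  by rewrite divr_gt0// ltr_wpDl// sqr_ge0.
have [P sP fP] := hf _ e4.
exists (fun x => c * P x); first exact: in_spanZ.
have mfP : cmeas (fun x => f x - P x) by apply: cmeasB => //; exact: cmeas_span.
under [X in sqnorm _ X]eq_fun do rewrite -mulrBr.
rewrite sqnormZ//.
have c1 : 0 < normc c ^+ 2 + 1 by rewrite ltr_wpDl// sqr_ge0.
apply: (@le_lt_trans _ _ ((normc c ^+ 2)%:E * (e / (normc c ^+ 2 + 1))%:E)%E).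
  by rewrite lee_wpmul2l ?lee_fin ?sqr_ge0// ltW.
rewrite -EFinM lte_fin mulrA ltr_pdivrMr// mulrC ltr_pM2l//; lra.
Qed.

Lemma in_closure_sum (I : Type) (s : seq I) (F : I -> R -> R[i]) :
  (forall i, in_closure (F i)) -> in_closure (fun x => \sum_(i <- s) F i x).
Proof.
move=> HF; elim: s => [|i s IH].
  under [X in in_closure X]eq_fun do rewrite big_nil.
  split; first by split; exact: measurable_cst.
  move=> e e0; exists (fun=> 0); first by exists [::]; split => // x; rewrite big_nil.
  by apply: sqnorm_lt0 => // x; rewrite subrr.
by under [X in in_closure X]eq_fun do rewrite big_cons; exact: in_closureD.
Qed.

Lemma in_closure_lim f : cmeas f -> (forall e : R, 0 < e ->
  exists2 g, in_closure g & (sqnorm mu (fun x => f x - g x)%R < e%:E)%E) -> in_closure f.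
Proof.
move=> mf H; split => // e e0; have e4 : 0 < e / 4 by rewrite divr_gt0.
have [g [mg hg] fg] := H _ e4; have [P sP gP] := hg _ e4; exists P => //.
have mfg : cmeas (fun x => f x - g x) by exact: cmeasB.
have mgP : cmeas (fun x => g x - P x) by apply: cmeasB => //; exact: cmeas_span.
rewrite (_ : (fun x => _) = fun x => (f x - g x) + (g x - P x)); last first.
  by apply/funext => x; rewrite addrA subrK.
apply: (le_lt_trans (sqnormD mu mfg mgP)).
have -> : e%:E = (2%:E * (e / 4)%:E + 2%:E * (e / 4)%:E)%E.
  by rewrite -!EFinM -EFinD; congr EFin; lra.
by apply: lteD; rewrite lte_pmul2l// lte_fin.
Qed.

Lemma in_closure_dominated (u_ : nat -> R -> R[i]) u (G : R -> R) :
  (forall n, in_closure (u_ n)) -> cmeas u ->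
  mu.-integrable setT (EFin \o (G : measurableTypeR R -> R)) ->
  (forall x, (normc (u x - u_ n x) ^+ 2) @[n --> \oo] --> (0 : R)) ->
  (forall n x, normc (u x - u_ n x) ^+ 2 <= G x) -> in_closure u.
Proof.
move=> cu mu0 iG cv dom; apply: in_closure_lim => // e e0.
by have [n hn] := sqnorm_dominated (fun n => (cu n).1) mu0 iG cv dom e0; exists (u_ n).
Qed.

Hypothesis closure_expi : forall w, in_closure (fun x => expi (2 * pi * w * x)).

Lemma in_closure_trig g : trig g -> in_closure g.
Proof.
move=> [s /funext ->]; apply: in_closure_sum => p; apply: in_closureZ.
have := closure_expi (p.2 / (2 * pi)).
by rewrite [2 * pi * _]mulrC mulfVK// lt0r_neq0// mulr_gt0// pi_gt0.
Qed.

(** The bound [C] of the approximant on the whole line is essential: outside the window the squared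
    error is at most (2 C)^2, and tightness makes the mass there small. *)
Lemma in_closure_BC (f : R -> R) : BC f -> in_closure (fun x => (f x)%:C%C).
Proof.
move=> bf; have [cf [C fC]] := bf.
have C0 : 0 <= C by apply: le_trans (fC 0).
have mf : cmeas (fun x => (f x)%:C%C) by apply: cmeasR; exact: continuous_measurable_fun.
apply: in_closure_lim => // e e0.
have e1 : 0 < e / (8 * C ^+ 2 + 1) by rewrite divr_gt0//; have := sqr_ge0 C; lra.
have [M M0 hM] := tight_integral mu e1.
(* The cap at 1 gives e2^2 <= e2 <= e / 4. *)
pose e2 := Num.min 1 (e / 4).
have e20 : 0 < e2 by rewrite /e2 lt_min ltr01 divr_gt0.
have [g [tg gC gf]] := trig_approx (M + 1) cf fC e20.
exists g; first exact: in_closure_trig.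
have bk : BC (fun x => e / 4 + 4 * C ^+ 2 * cut M x).
  by apply: BCD; [exact: BC_cst|exact/BCZ/BC_cut].
have mg : cmeas g by exact: (in_closure_trig tg).1.
apply: (@le_lt_trans _ _ (\int[mu]_x (e / 4 + 4 * C ^+ 2 * cut M x)%:E)%E).
  apply: ge0_le_integral => //.
  - by move=> x _; rewrite lee_fin sqr_ge0.
  - by apply: (@measurable_sqnormc _ (fun x => (f x)%:C%C - g x)); exact: cmeasB.
  - by apply/measurable_EFinP; apply: continuous_measurable_fun; exact: bk.1.
  - move=> x _; rewrite lee_fin.
    have kk : e / 4 <= e / 4 + 4 * C ^+ 2 * cut M x.
      by rewrite lerDl mulr_ge0 ?cut_ge0// mulr_ge0// sqr_ge0.
    have [xM|xM] := leP `|x| (M + 1).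
      apply: le_trans kk; have := gf x xM; rewrite -normcN opprB => h.
      apply: (@le_trans _ _ (e2 ^+ 2)); first by rewrite ler_sqr ?nnegrE ?normc_ge0// ltW.
      have e2e : e2 <= e / 4 by rewrite /e2 ge_min lexx orbT.
      apply: le_trans e2e; rewrite expr2 -[leRHS]mulr1 ler_pM2l//.
      by rewrite /e2 ge_min lexx.
    rewrite (cut1 (ltW xM)) mulr1.
    have h : normc ((f x)%:C%C - g x) <= 2 * C.
      apply: (le_trans (le_normcD _ _)); rewrite normcN normcR.
      by have := fC x; have := gC x; lra.
    apply: (@le_trans _ _ ((2 * C) ^+ 2)).
      by rewrite ler_sqr ?nnegrE ?normc_ge0// mulr_ge0.
    by rewrite exprMn -natrX lerDr divr_ge0// ltW.
have fin := integrable_BC mu bk.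
have := integrable_fin_num measurableT fin; rewrite /= => fn.
rewrite -(fineK fn) lte_fin.
have -> : fine (\int[mu]_x (e / 4 + 4 * C ^+ 2 * cut M x)%:E) =
    \int[mu]_x (e / 4 + 4 * C ^+ 2 * cut M x) by [].
have pI := posfun_integral mu.
rewrite (posfunD pI (BC_cst _) (BCZ _ (BC_cut M))) (posfun_cst _ pI) (posfunZ pI _ (BC_cut M)).
have : 4 * C ^+ 2 * \int[mu]_x cut M x <= 4 * C ^+ 2 * (e / (8 * C ^+ 2 + 1)).
  by rewrite ler_wpM2l// mulr_ge0// sqr_ge0.
have : 4 * C ^+ 2 * (e / (8 * C ^+ 2 + 1)) <= e / 2.
  have := sqr_ge0 C; move: (C ^+ 2) => D D0.
  by rewrite mulrA ler_pdivrMr; nra.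
lra.
Qed.

Notation indic A := (fun x : R => (\1_(A : set R) x)%:C%C).

Lemma in_closure_halfline a : in_closure (indic `]-oo, a]).
Proof.
apply: (@in_closure_dominated (fun n x => (ramp a n.+1%:R^-1 x)%:C%C) _ (fun=> 1)).
- by move=> n; apply: in_closure_BC; exact: BC_ramp.
- by apply: cmeasR; apply: measurable_indic; exact: measurable_itv.
- exact: integrable_BC (BC_cst 1).
- move=> x; apply: cvg_near_cst; have [xa|ax] := leP x a.
    apply: nearW => n; rewrite ramp1// indicE mem_set ?in_itv// subrr.
    by rewrite ComplexField.Normc.normc0 expr0n.
  have xa0 : 0 < x - a by rewrite subr_gt0.
  near=> n; rewrite ramp0//; last first.
    rewrite -lerBrDl; apply: ltW; near: n.
    exact: (near_infty_natSinv_lt (PosNum xa0)).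
  rewrite indicE memNset ?subr0; last by rewrite /= in_itv/= leNgt ax.
  by rewrite ComplexField.Normc.normc0 expr0n.
- move=> n x; rewrite -rmorphB normcR real_normK ?num_real//.
  rewrite -[leRHS](expr1n _ 2) -[leLHS]real_normK ?num_real// ler_sqr ?nnegrE//.
  have := ramp_ge0 a n.+1%:R^-1 x; have := ramp_le1 a n.+1%:R^-1 x.
  by rewrite indicE ler_norml; case: (_ \in _) => /= *; apply/andP; split; lra.
Unshelve. all: end_near. Qed.

(* Dynkin's pi-lambda theorem on half-open intervals. *)
Lemma in_closure_indic (A : set (measurableTypeR R)) : measurable A -> in_closure (indic A).
Proof.
pose G : set (set R) := R.-ocitv.-measurable.
apply: (@dynkin_induction _ (measurableTypeR R) G (fun A => in_closure (indic A))).
- by [].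
- by move=> X Y; exact: (@measurableI _ (ocitv_type R)).
- have := in_closure_BC (BC_cst 1); congr in_closure; apply/funext => x.
  by rewrite indicT.
- move=> _ [[a b] _ <-] /=.
  have [ab|ba] := leP a b.
    have := in_closureD (in_closure_halfline b) (in_closureZ (-1) (in_closure_halfline a)).
    congr in_closure; apply/funext => x; rewrite mulN1r -rmorphB; congr (_%:C%C).
    rewrite !indicE !(asboolb, mem_setE) !in_itv/=.
    have [xb|xb] := leP x b; have [xa|xa] := leP x a => //=; rewrite ?subr0 ?subrr//.
    by have := lt_le_trans xb (le_trans xa ab); rewrite ltxx.
  have := in_closure_BC (BC_cst 0); congr in_closure; apply/funext => x.
  by rewrite set_itv_ge ?indic0// bnd_simp -leNgt ltW.
- move=> S _ cS; have := in_closureD (in_closure_BC (BC_cst 1)) (in_closureZ (-1) cS).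
  congr in_closure; apply/funext => x; rewrite mulN1r -rmorphB; congr (_%:C%C).
  by rewrite !indicE in_setC; case: (_ \in _); rewrite ?subr0 ?subrr.
- move=> F mF tF cF.
  (* Disjointness makes the indicator of each partial union a finite sum of indicators; these
     increase to that of the whole union, with majorant 1. *)
  pose U n : set R := [set x | exists2 i, (i < n)%N & F i x].
  have cU n : in_closure (indic (U n)).
    elim: n => [|n IH].
      have := in_closure_BC (BC_cst 0); congr in_closure; apply/funext => x.
      by rewrite indicE memNset// => -[].
    have := in_closureD IH (cF n); congr in_closure; apply/funext => x.
    rewrite -rmorphD; congr (_%:C%C); rewrite !indicE.
    have [xF|xF] := boolP (x \in F n).
      rewrite (memNset (A := U n)) ?add0r ?mem_set//; first by exists n => //; exact: set_mem.
      move=> [i iN Fi]; have := tF i n Logic.I Logic.I (ex_intro _ x (conj Fi (set_mem xF))).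
      by move=> E; rewrite E ltnn in iN.
    rewrite addr0; congr (_%:R); congr nat_of_bool; apply/idP/idP => /set_mem [i iN Fi]; apply/mem_set.
      by exists i => //; exact: ltnW.
    exists i => //; move: iN; rewrite ltnS leq_eqVlt => /orP[/eqP iE|//].
    by move: xF; rewrite -iE => /negP; case; exact: mem_set.
  apply: (@in_closure_dominated (fun n => indic (U n)) _ (fun=> 1)).
  + exact: cU.
  + by apply: cmeasR; apply: measurable_indic; exact: bigcup_measurable.
  + exact: integrable_BC (BC_cst 1).
  + move=> x; apply: cvg_near_cst; have [[k _ Fk]|xU] := pselect ((\bigcup_k F k) x).
      near=> n; rewrite !indicE !mem_set ?subrr ?ComplexField.Normc.normc0 ?expr0n//.
        by exists k => //; near: n; exact: nbhs_infty_gt.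
      by exists k.
    apply: nearW => n; rewrite !indicE !memNset ?subrr ?ComplexField.Normc.normc0 ?expr0n//.
    by move=> [k _ Fk]; apply: xU; exists k.
  + move=> n x; rewrite -rmorphB normcR !indicE.
    by case: (_ \in _); case: (_ \in _); rewrite /= ?subrr ?subr0 ?sub0r ?normrN ?normr1 ?normr0 ?expr1n ?expr0n.
Unshelve. all: end_near. Qed.

(** Simple functions 0 <= g_n <= f converge to [f], and (f - g_n)^2 <= f^2 provides the integrable
    majorant. *)
Lemma in_closure_nneg_sqr (f : measurableTypeR R -> R) : measurable_fun setT f ->
  (forall x, 0 <= f x) -> mu.-integrable setT (EFin \o (fun x => f x ^+ 2)) ->
  in_closure (fun x => (f x)%:C%C).
Proof.
move=> mf f0 if2.
have mf' : measurable_fun setT (EFin \o f) by exact/measurable_EFinP.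
pose h := nnsfun_approx measurableT mf'; pose g n : R -> R := h n.
have gc x : g n x @[n --> \oo] --> f x.
  exact: (fine_cvg (@cvg_nnsfun_approx _ _ _ _ measurableT _ mf' (fun x _ => f0 x) x Logic.I)).
have g_le n x : 0 <= g n x <= f x.
  apply/andP; split; first exact: fun_ge0.
  rewrite -(cvg_lim _ (gc x))//.
  apply: (nondecreasing_cvgn_le (u_ := fun n => g n x)); last exact: cvgP (gc x).
  by move=> i j ij; have /lefP := nd_nnsfun_approx measurableT mf' ij; apply.
apply: (@in_closure_dominated (fun n x => (g n x)%:C%C) _ (fun x => f x ^+ 2)).
- move=> n; rewrite (_ : (fun x => _) = fun x => \sum_(i < #|` fset_set (range (h n))|)
      ((fset_set (range (h n)))`_i)%:C%C * (\1_(h n @^-1` [set (fset_set (range (h n)))`_i]) x)%:C%C).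
    by apply: in_closure_sum => i; apply/in_closureZ/in_closure_indic.
  by apply/funext => x; rewrite /g fimfunEord raddf_sum; apply: eq_bigr => i _; rewrite /= rmorphM.
- exact: cmeasR.
- exact: if2.
- move=> x; rewrite [X in _ --> X](_ : 0 = `|f x - f x| ^+ 2); last by rewrite subrr normr0 expr0n.
  under eq_fun do rewrite -rmorphB normcR.
  rewrite expr2; under eq_fun do rewrite expr2.
  by apply: cvgM; apply: cvg_norm; apply: cvgB => //; exact: cvg_cst.
- move=> n x; rewrite -rmorphB normcR; have /andP[g0 gf] := g_le n x.
  by rewrite ler_sqr ?nnegrE// ger0_norm; lra.
Qed.

Lemma in_closure_Lfun2 (f : measurableTypeR R -> R) : f \in Lfun mu 2%:E ->
  in_closure (fun x => (f x)%:C%C).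
Proof.
move=> fL.
have mf : measurable_fun setT f by move: fL; rewrite inE => /andP[]; rewrite inE.
have if2 := Lfun2_integrable_sqr fL.
have H (g : measurableTypeR R -> R) : measurable_fun setT g -> (forall x, 0 <= g x <= `|f x|) ->
    in_closure (fun x => (g x)%:C%C).
  move=> mg gf; apply: in_closure_nneg_sqr => //; first by move=> x; case/andP: (gf x).
  apply: le_integrable if2 => //; first by apply/measurable_EFinP; exact: measurable_funX.
  move=> x _ /=; rewrite lee_fin !normrX !real_normK ?num_real//.
  have /andP[g0 g1] := gf x.
  by rewrite -(@real_normK _ (f x)) ?num_real// ler_sqr ?nnegrE.
have c1 : in_closure (fun x => (f^\+ x)%:C%C).
  apply: H; first exact: measurable_funrpos.
  move=> x; rewrite funrpos_ge0 /funrpos/= ge_max ler_norm normr_ge0//.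
have c2 : in_closure (fun x => (f^\- x)%:C%C).
  apply: H; first exact: measurable_funrneg.
  move=> x; rewrite funrneg_ge0 /funrneg/= ge_max normr_ge0 andbT -normrN ler_norm//.
have := in_closureD c1 (in_closureZ (-1) c2); congr in_closure; apply/funext => x.
by rewrite mulN1r -rmorphB; congr (_%:C%C); rewrite -[RHS](congr1 (@^~ x) (funrposBneg f)).
Qed.

Lemma in_closure_L2 f : inL2 mu f -> in_closure f.
Proof.
move=> [fR fI].
have := in_closureD (in_closure_Lfun2 fR) (in_closureZ 'i%C (in_closure_Lfun2 fI)).
by congr in_closure; apply/funext => x; rewrite -complexE.
Qed.

End closed_span.

(** * Gram expansions and projections of exponentials *)

Section spectral_criterion.
Context {R : realType}.
Variables (mu : borel_prob R).

Lemma inL2_expi w : inL2 mu (fun x => expi (w * x)).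
Proof.
have H (f : R -> R) : BC f -> (f : measurableTypeR R -> R) \in Lfun mu 2%:E.
  move=> bf; have [cf [C fC]] := bf.
  rewrite inE; apply/andP; split; first by rewrite inE; exact: continuous_measurable_fun.
  rewrite inE /finite_norm unlock; apply: poweR_lty.
  have -> : (\int[mu]_x `|(f x)%:E| `^ 2 = \int[mu]_x (f x * f x)%:E)%E.
    apply: eq_integral => x _.
    by rewrite /= powR_mulrn// real_normK ?num_real// expr2.
  have bff : BC (fun x => f x * f x).
    split; first by move=> x; apply: cvgM; exact: cf.
    by exists (C * C) => x; rewrite normrM ler_pM.
  by have /integrable_fin_num := integrable_BC mu bff; rewrite /= ltey_eq => ->.
by split; apply: H; [exact: BC_cos|exact: BC_sin].
Qed.

Lemma L2norm_lt f (e : R) : 0 < e -> (sqnorm mu f < (e ^+ 2)%:E)%E -> (L2norm mu f < e%:E)%E.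
Proof.
move=> e0 h; rewrite /L2norm unlock.
have -> : (\int[mu]_x `|(EFin \o (fun x => normc (f x))) x| `^ 2 = sqnorm mu f)%E.
  apply: eq_integral => x _ /=.
  by rewrite powR_mulrn// real_normK ?num_real.
have -> : e%:E = ((e ^+ 2)%:E `^ 2^-1)%E.
  by rewrite poweR_EFin -powR_mulrn ?ltW// -powRrM mulfV// powRr1// ltW.
have : (0 <= sqnorm mu f)%E by apply: integral_ge0 => x _; rewrite lee_fin sqr_ge0.
case: (sqnorm mu f) h => // s; rewrite lte_fin => h; rewrite lee_fin => s0.
by rewrite !poweR_EFin lte_fin; apply: gt0_ltr_powR; rewrite ?nnegrE ?sqr_ge0.
Qed.

Lemma fourier0 : fourier mu 0 = 1.
Proof.
apply/eqP; rewrite eq_complex Re_fourier Im_fourier; apply/andP; split; apply/eqP.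
  under eq_Rintegral do rewrite mulr0 mul0r cos0.
  by rewrite (posfun1 (posfun_integral mu)).
under eq_Rintegral do rewrite mulr0 mul0r sin0.
by rewrite (posfun_cst 0 (posfun_integral mu)) oppr0.
Qed.

Lemma fourierN xi : fourier mu (- xi) = (fourier mu xi)^*%C.
Proof.
have RN := Re_fourier mu (- xi); have IN := Im_fourier mu (- xi).
have R0 := Re_fourier mu xi; have I0 := Im_fourier mu xi.
apply/eqP; rewrite eq_complex RN IN; case: (fourier mu xi) R0 I0 => a b /= -> ->.
apply/andP; split; apply/eqP.
  by apply: eq_Rintegral => x _; rewrite mulrN mulNr cosN.
rewrite opprK; under eq_Rintegral do rewrite mulrN mulNr sinN -mulN1r.
by rewrite (posfunZ (posfun_integral mu) (-1) (BC_sin _)) mulN1r opprK.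
Qed.

Lemma integral_Re_expi (c : R[i]) w :
  \int[mu]_x complex.Re (c * expi (2 * pi * w * x)) = complex.Re (c * fourier mu (- w)).
Proof.
have pI := posfun_integral mu.
have RN := Re_fourier mu (- w); have IN := Im_fourier mu (- w).
case: (fourier mu (- w)) RN IN => a b /= -> ->; case: c => c d /=.
under eq_Rintegral do rewrite -mulNr.
rewrite (posfunD pI (BCZ c (BC_cos _)) (BCZ (- d) (BC_sin _))).
rewrite (posfunZ pI _ (BC_cos _)) (posfunZ pI _ (BC_sin _)).
have -> : \int[mu]_x cos (2 * pi * - w * x) = \int[mu]_x cos (2 * pi * w * x).
  by apply: eq_Rintegral => x _; rewrite mulrN mulNr cosN.
have -> : \int[mu]_x sin (2 * pi * - w * x) = - \int[mu]_x sin (2 * pi * w * x).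
  under eq_Rintegral do rewrite mulrN mulNr sinN -mulN1r.
  by rewrite (posfunZ pI (-1) (BC_sin _)) mulN1r.
by rewrite opprK mulNr.
Qed.

Lemma conjcM (z w : R[i]) : (z * w)^*%C = z^*%C * w^*%C.
Proof. exact: rmorphM. Qed.

Lemma BC_Re_trig (t : seq (R[i] * R)) :
  BC (fun x => complex.Re (\sum_(p <- t) p.1 * expi (2 * pi * p.2 * x))).
Proof.
elim: t => [|[[a b] w] t IH].
  by have := BC_cst (0 : R); congr BC; apply/funext => x; rewrite big_nil.
have := BCD (BCD (BCZ a (BC_cos (2 * pi * w))) (BCZ (- b) (BC_sin (2 * pi * w)))) IH.
by congr BC; apply/funext => x; rewrite big_cons ReD /= mulNr.
Qed.

Lemma integral_Re_trig (t : seq (R[i] * R)) :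
  \int[mu]_x complex.Re (\sum_(p <- t) p.1 * expi (2 * pi * p.2 * x)) =
  complex.Re (\sum_(p <- t) p.1 * fourier mu (- p.2)).
Proof.
elim: t => [|p t IH].
  rewrite big_nil; under eq_Rintegral do rewrite big_nil.
  exact: (posfun_cst 0 (posfun_integral mu)).
under eq_Rintegral do rewrite big_cons ReD.
have b1 : BC (fun x => complex.Re (p.1 * expi (2 * pi * p.2 * x))).
  by have := BC_Re_trig [:: p]; congr BC; apply/funext => x; rewrite big_seq1.
rewrite (posfunD (posfun_integral mu) b1 (BC_Re_trig t)) IH.
by rewrite integral_Re_expi big_cons ReD.
Qed.

(** The squared modulus of a trigonometric polynomial is again one, [T], so it integrates term by
    term; the sign in [fourier] reverses the frequency differences. *)
Lemma sqnorm_trig (t : seq (R[i] * R)) :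
  sqnorm mu (fun x => \sum_(p <- t) p.1 * expi (2 * pi * p.2 * x)) =
  (complex.Re (\sum_(p <- t) \sum_(r <- t) p.1 * (r.1)^*%C * fourier mu (r.2 - p.2)))%:E.
Proof.
pose T := [seq (p.1 * (r.1)^*%C, p.2 - r.2) | p <- t, r <- t].
have E x : normc (\sum_(p <- t) p.1 * expi (2 * pi * p.2 * x)) ^+ 2 =
    complex.Re (\sum_(p <- T) p.1 * expi (2 * pi * p.2 * x)).
  rewrite big_allpairs_dep/= -[LHS]/(complex.Re ((normc _ ^+ 2)%:C%C)) -mulr_conjc.
  congr complex.Re; rewrite raddf_sum mulr_suml; apply: eq_bigr => p _.
  rewrite mulr_sumr; apply: eq_bigr => r _.
  rewrite [X in _ * X]conjcM expi_conj mulrACA -expiD; congr (_ * expi _); ring.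
rewrite /sqnorm; under eq_integral do rewrite E.
have := integrable_fin_num measurableT (integrable_BC mu (BC_Re_trig T)).
rewrite /= => /fineK <-; congr EFin.
rewrite -[LHS]/(\int[mu]_x complex.Re (\sum_(p <- T) p.1 * expi (2 * pi * p.2 * x))).
rewrite integral_Re_trig big_allpairs_dep; congr complex.Re.
by apply: eq_bigr => p _; apply: eq_bigr => r _; rewrite /= opprB.
Qed.

(* The residual of the orthogonal projection of an exponential onto the span of [s]. *)
Lemma sqnorm_expi_projection (s : seq R) xi : uniq s ->
  (forall l l', l \in s -> l' \in s -> l != l' -> fourier mu (l - l') = 0) ->
  sqnorm mu (fun x => expi (2 * pi * xi * x) -
    \sum_(l <- s) fourier mu (l - xi) * expi (2 * pi * l * x)) =
  (1 - \sum_(l <- s) normc (fourier mu (l - xi)) ^+ 2)%:E.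
Proof.
move=> us orth.
pose t := (1 : R[i], xi) :: [seq (- fourier mu (l - xi), l) | l <- s].
rewrite (_ : (fun x => _) = fun x => \sum_(p <- t) p.1 * expi (2 * pi * p.2 * x)); last first.
  apply/funext => x; rewrite /t big_cons big_map mul1r -sumrN; congr (_ + _).
  by apply: eq_bigr => l _; rewrite mulNr.
rewrite sqnorm_trig; congr EFin.
rewrite -[RHS]/(complex.Re ((1 - \sum_(l <- s) normc (fourier mu (l - xi)) ^+ 2)%:C%C)).
congr complex.Re; rewrite rmorphB rmorph1 raddf_sum.
have tE (F : R[i] * R -> R[i]) : \sum_(p <- t) F p =
    F (1, xi) + \sum_(l <- s) F (- fourier mu (l - xi), l) by rewrite /t big_cons big_map.
rewrite tE tE; cbn [fst snd]; rewrite conjc1 !mul1r subrr fourier0 -addrA; congr (_ + _).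
have E1 : \sum_(l <- s) 1 * (- fourier mu (l - xi))^*%C * fourier mu (l - xi) =
    - \sum_(l <- s) (normc (fourier mu (l - xi)) ^+ 2)%:C%C.
  rewrite -sumrN; apply: eq_bigr => l _.
  by rewrite mul1r [(- _)^*%C]raddfN mulNr mulrC mulr_conjc.
rewrite E1 -[RHS]addr0; congr (_ + _).
apply: big1_seq => l /andP[_ ls]; rewrite tE; cbn [fst snd].
rewrite conjc1 mulr1 (bigD1_seq l ls us); cbn [fst snd].
rewrite subrr fourier0 mulr1 big1_seq ?addr0.
  rewrite -(opprB l xi) fourierN [(- _)^*%C]raddfN mulrN mulNr opprK.
  by rewrite [X in _ + X]addr0 addNr.
by move=> l' /andP[l'l l's]; rewrite (orth l' l l's ls l'l) mulr0.
Qed.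

(** A list in [in_span] may repeat a frequency, whereas [orthonormal_basis] wants coefficients that
    depend on the frequency: equal frequencies are grouped. *)
Lemma span_representation (Lam : set R) P : in_span Lam P -> exists (s : seq R) (c : R -> R[i]),
  (forall l, l \in s -> Lam l) /\ forall x, P x = \sum_(l <- s) c l * expi (2 * pi * l * x).
Proof.
move=> [t [tL tP]]; pose s := undup [seq p.2 | p <- t].
exists s, (fun l => \sum_(p <- t | p.2 == l) p.1); split.
  by move=> l; rewrite mem_undup => /mapP[p /tL h ->].
move=> x; rewrite tP; under [RHS]eq_bigr do rewrite mulr_suml big_mkcond.
rewrite exchange_big/=; apply: eq_big_seq => p pt.
rewrite (bigD1_seq p.2) ?undup_uniq//=; last by rewrite mem_undup map_f.
by rewrite eqxx big1 ?addr0// => l /negbTE; rewrite eq_sym => ->.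
Qed.

End spectral_criterion.

(** * The union of the nested spectra is a spectrum *)

Section spectrum_criterion.
Context {R : realType}.
Variables (mu : borel_prob R) (Lam : nat -> seq int).
Hypothesis Lam_ext : forall j, exists ext, Lam j.+1 = Lam j ++ ext.
Hypothesis Lam_uniq : forall j, uniq (Lam j).
Hypothesis Lam_orth : forall j (l l' : int), l \in Lam j -> l' \in Lam j -> l != l' ->
  fourier mu (l%:~R - l'%:~R) = 0.
Hypothesis Lam_parseval : forall xi : R,
  \sum_(l <- Lam j) normc (fourier mu (xi + l%:~R)) ^+ 2 @[j --> \oo] --> (1 : R).

Definition frequencies : set R := [set r | exists j l, l \in Lam j /\ r = l%:~R].

Let mem_Lam i j l : (i <= j)%N -> l \in Lam i -> l \in Lam j.
Proof.
move=> /subnKC <-; elim: (j - i)%N => [|k IH] li; first by rewrite addn0.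
by rewrite addnS; have [e ->] := Lam_ext (i + k)%N; rewrite mem_cat IH.
Qed.

Lemma frequencies_orthonormal a b : frequencies a -> frequencies b ->
  L2inner mu (fun x => expi (2 * pi * a * x)) (fun x => expi (2 * pi * b * x)) = (a == b)%:R.
Proof.
move=> [i [l [li ->]]] [j [l' [lj ->]]].
have -> : L2inner mu (fun x => expi (2 * pi * l%:~R * x)) (fun x => expi (2 * pi * l'%:~R * x)) =
    fourier mu (l'%:~R - l%:~R).
  rewrite /L2inner /fourier; congr cintegral; apply/funext => x.
  by rewrite expi_conj -expiD; congr expi; ring.
rewrite eqr_int; have [->|ll'] := eqVneq; first by rewrite subrr fourier0.
apply: (@Lam_orth (maxn i j)); last by rewrite eq_sym.
  by apply: mem_Lam lj; exact: leq_maxr.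
by apply: mem_Lam li; exact: leq_maxl.
Qed.

(** The squared residual of the projection onto the exponentials of [Lam j] is 1 minus the Parseval
    sum at [- w], hence tends to 0. *)
Lemma frequencies_complete w : in_closure mu frequencies (fun x => expi (2 * pi * w * x)).
Proof.
split; first exact: cmeas_expi.
move=> e e0; have /cvgrPdist_lt/(_ _ e0)[j _ /(_ j (leqnn j)) h] := Lam_parseval (- w).
pose s : seq R := [seq l%:~R | l <- Lam j].
have intrI : injective (fun l : int => l%:~R : R) by exact: mulrIz (oner_neq0 R).
exists (fun x => \sum_(l <- s) fourier mu (l - w) * expi (2 * pi * l * x)).
  exists [seq (fourier mu (l - w), l) | l <- s]; split; last by move=> x; rewrite [RHS]big_map.
  by move=> _ /mapP[_ /mapP[l lj ->] ->]; exists j, l.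
rewrite sqnorm_expi_projection; first last.
- move=> _ _ /mapP[l lj ->] /mapP[l' l'j ->]; rewrite eqr_int; exact: Lam_orth lj l'j.
- by rewrite map_inj_uniq.
rewrite lte_fin big_map; apply: le_lt_trans (ler_norm _) _.
by under eq_bigr do rewrite addrC.
Qed.

Lemma frequencies_spectrum : is_spectrum mu frequencies.
Proof.
split.
  apply: (@sub_countable _ _ _ (range (fun k : int => k%:~R : R))).
    by apply: subset_card_le => _ [j [l [_ ->]]]; exists l.
  by apply: sub_countable (card_image_le _ _) _; exact: countableP.
split; first by move=> a _; exact: inL2_expi.
  exact: frequencies_orthonormal.
move=> f fL2 e e0.
have [_ /(_ _ (exprn_gt0 2 e0))[P PL Pf]] := in_closure_L2 frequencies_complete fL2.
have [s [c [sL Pc]]] := span_representation PL.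
exists s, c; split=> //; apply: L2norm_lt => //.
by under eq_fun do rewrite -Pc.
Qed.

End spectrum_criterion.

Theorem theorem1p4 (R : realType)
    (N : nat -> int) (B L : nat -> {fset int})
    (hHad : forall n, (1 <= n)%N -> hadamard_triple R (N n) (B n) (L n))
    (mu : borel_prob R)
    (hmu : weakly_cvg (partial_convolution N B 0) mu)
    (hequi : exists n_ : nat -> nat,
      [/\ forall i j : nat, (i < j)%N -> (n_ i < n_ j)%N,
          forall j : nat, (1 <= n_ j)%N &
          equi_positive (@tail_family R N B n_)]) :
  exists Lambda : set R,
    is_spectrum mu Lambda /\ Lambda `<=` range (fun k : int => k%:~R : R).
Proof.
have [n_ [n_incr _ [eps [delta [eps0 delta0 eqpos]]]]] := hequi.
have [nn [Lam H]] := spectral_tower_exists hHad hmu n_incr delta0 (fun x h nu => @eqpos x h nu).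
exists (frequencies Lam); split; last by move=> _ [j [l [_ ->]]]; exists l.
have sp j : @spectrum_of R N B (nn j) (Lam j) by have [] := H j.
apply: frequencies_spectrum.
- by move=> j; have [] := H j.
- by move=> j; have [] := spectrum_orthogonal hHad hmu (sp j).
- by move=> j; have [] := spectrum_orthogonal hHad hmu (sp j).
- exact: (parseval_tower hHad hmu eps0 delta0 H).
Qed.
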